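(* Let $X$ be a real $L_1$-predual Banach space. Then $X$ contains no isomorphic copy of $\ell_1$ if and only if $X$ has property $(\overline{\mathrm{P1}})$.
   Context: A real $L_1$-predual is a real Banach space $X$ whose dual $X^*$ is isometrically isomorphic to $L_1(\mu)$ for some measure $\mu$. For a Banach space $X$, $B_X$ is the closed unit ball. For $f\in B_{X^*}$ and $\varepsilon>0$, the slice of $B_X$ is $S(B_X,f,\varepsilon)=\{x\in B_X:\ \mathrm{Re}\, f(x)>\sup_{c\in B_X}|f(c)|-\varepsilon\}$. A convex combination of slices of $B_X$ is a set $\sum_{i=1}^n\lambda_i S_i=\{\sum_{i=1}^n \lambda_i x_i: x_i\in S_i\}$ with $n\in\mathbb{N}$, $\lambda_i>0$, $\sum_{i=1}^n\lambda_i=1$ and each $S_i$ a slice of $B_X$. $X$ has property $(\overline{\mathrm{P1}})$ if for every convex combination of slices $C$ of $B_X$ and every $x\in C$ there exists a relatively weakly open subset $W$ of $B_X$ with $x\in W\subseteq\overline{C}$ (norm closure). *)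

(* Defs.v *)
From HB Require Import structures.
From mathcomp Require Import all_boot all_order all_algebra.
From mathcomp Require Import all_classical all_reals all_analysis.

Set Implicit Arguments.
Unset Strict Implicit.
Unset Printing Implicit Defensive.
Import Order.TTheory GRing.Theory Num.Theory.
Import numFieldNormedType.Exports.

Local Open Scope classical_set_scope.
Local Open Scope ring_scope.

Definition unit_ball {R : realType} (X : normedModType R) : set X :=
  [set x | `|x| <= 1].
Arguments unit_ball {R} X _.

Definition dual {R : realType} (X : normedModType R) : set (X -> R^o) :=
  [set f | linear f /\ continuous f].
Arguments dual {R} X _.

(* `sup` is junk on unbounded sets; elements of the dual are bounded on the
   unit ball, so this is the usual norm of X^* there. *)
Definition dual_norm {R : realType} (X : normedModType R) (f : X -> R^o) : R :=
  sup [set `|f x| | x in unit_ball X].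

(* The carrier X with the coarsest topology making every f in X^* continuous. *)
Definition weak_topology {R : realType} (X : normedModType R) : Type :=
  sup_topology (fun f : dual X =>
    Topological.class (initial_topology (set_val f : X -> R^o))).
HB.instance Definition _ (R : realType) (X : normedModType R) :=
  Topological.copy (weak_topology X)
    (sup_topology (fun f : dual X =>
      Topological.class (initial_topology (set_val f : X -> R^o)))).

Definition relatively_weakly_open {R : realType} (X : normedModType R)
    (W : set X) : Prop :=
  exists2 V : set (weak_topology X), open V & W = unit_ball X `&` V.

(* A linear isometric bijection from X^* onto L_1(mu). The library equips the
   quotient LspaceType1 mu with neither a module structure nor a norm, so
   linearity is expressed almost everywhere on representatives. *)
Definition isometric_dual_L1 {R : realType} (X : normedModType R)
    (d : measure_display) (T : measurableType d)
    (mu : {measure set T -> \bar R})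
    (J : (X -> R^o) -> LspaceType1 mu) : Prop :=
  [/\ set_bij (dual X) [set: LspaceType1 mu] J,
      forall (a : R) (f g : X -> R^o), dual X f -> dual X g ->
        J (fun x => a * f x + g x) = (fun t => a * J f t + J g t) %[ae mu] &
      forall f : X -> R^o, dual X f ->
        ('N[mu]_1%:E[EFin \o J f] = (dual_norm f)%:E)%E].

Definition L1_predual {R : realType} (X : normedModType R) : Prop :=
  exists (d : measure_display) (T : measurableType d)
    (mu : {measure set T -> \bar R}) (J : (X -> R^o) -> LspaceType1 mu),
    isometric_dual_L1 J.

Definition ell1 (R : realType) : set (R^nat) :=
  [set a | cvgn ([series `|a n|]_n : R^nat)].
Arguments ell1 R _ : clear implicits.

Definition ell1_norm {R : realType} (a : R^nat) : R :=
  limn ([series `|a n|]_n : R^nat).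

(* Only the values of J on ell1 are relevant. *)
Definition contains_ell1 {R : realType} (X : normedModType R) : Prop :=
  exists (J : R^nat -> X) (m M : R),
    [/\ 0 < m,
        forall (k : R) (a b : R^nat), ell1 R a -> ell1 R b ->
          J (fun n => k * a n + b n) = k *: J a + J b &
        forall a : R^nat, ell1 R a ->
          m * ell1_norm a <= `|J a| <= M * ell1_norm a].

Definition slice {R : realType} (X : normedModType R) (f : X -> R^o) (e : R) :
    set X :=
  [set x | unit_ball X x /\
           sup [set `|f c| | c in unit_ball X] - e < f x].

Definition is_slice {R : realType} (X : normedModType R) (S : set X) : Prop :=
  exists (f : X -> R^o) (e : R),
    [/\ dual X f, dual_norm f <= 1, 0 < e & S = slice f e].

Definition convex_comb_slices {R : realType} (X : normedModType R)
    (C : set X) : Prop :=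
  exists (n : nat) (lambda : 'I_n -> R) (S : 'I_n -> set X),
    [/\ forall i, 0 < lambda i,
        \sum_i lambda i = 1,
        forall i, is_slice (S i) &
        C = [set \sum_i lambda i *: x i | x in [set x | forall i, S i (x i)]]].

Definition property_P1bar {R : realType} (X : normedModType R) : Prop :=
  forall (C : set X) (x : X), convex_comb_slices C -> C x ->
    exists W : set X,
      [/\ relatively_weakly_open W, W x & W `<=` closure C].

(* Main.v *)
Require Import Defs.
From HB Require Import structures.
From mathcomp Require Import all_boot all_order all_algebra.
From mathcomp Require Import all_classical all_reals all_analysis.
From mathcomp Require Import measurable_realfun ring lra.

Set Implicit Arguments.
Unset Strict Implicit.
Unset Printing Implicit Defensive.
Import Order.TTheory GRing.Theory Num.Theory.
Import numFieldNormedType.Exports.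

Local Open Scope classical_set_scope.
Local Open Scope ring_scope.

(** Identify [X^*] with [L_1(mu)] and let [P A] be the multiplication by the
    indicator of [A]. Either every nonzero [P A F] has a nonzero restriction to an
    atom (a set [A] such that [P A] has rank at most one), or some [F] is nonzero
    on a set [B] on which it has no atom. Both properties are decided by this
    alternative.

    In the atomic case, finitely many atoms carry the functionals defining given
    slices up to a small norm. On an atom a convex combination of numbers of
    [[-1, 1]] can be perturbed by perturbing its terms, so a point [y] of the ball
    weakly close to [x = \sum la_i x_i] decomposes in the bidual as
    [\sum la_i psi_i] with [psi_i] in the slices; Goldstine and Hahn-Banach bring
    this back to the closure of the convex combination of slices. If [X]
    contained a copy of [ell_1] with basis [e], averaging over signs Hahn-Banach
    functionals with prescribed signs on [e] would give [g_n] in [X^*], bounded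
    away from 0, with [|\sum b_k g_k| <= K |b|_2]. They vanish asymptotically on
    each atom, so a gliding hump yields sums of [j] of them of norm at least a
    multiple of [j], against [K sqrt j].

    In the diffuse case, [B] splits into two halves on which the functionals of
    a given weak neighbourhood of 0 almost agree; this gives points of that
    neighbourhood which are far from [S(f)/2 + S(-f)/2], where [f] is the
    normalised restriction of [F] to [B]. Choosing by Goldstine's theorem elements
    of the ball that are close to successive Rademacher functions on [B], and
    passing to subsets with the Hahn decomposition, one gets a sequence all of whose sign
    patterns are realised by functionals, hence equivalent to the basis of [ell_1]. *)

(** * Hahn-Banach in the form of Mazur and Orlicz *)

Section mazur_orlicz.
Context {R : realType} {V : lmodType R}.
Implicit Types (p q l : V -> R) (D : set (V * R)).

Definition sublinear p :=
  (forall u v, p (u + v) <= p u + p v) /\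
  (forall a u, 0 <= a -> p (a *: u) = a * p u).

Definition convex_cone D :=
  [/\ D (0, 0), forall x y, D x -> D y -> D (x + y) &
      forall (a : R) x, 0 <= a -> D x -> D (a *: x.1, a * x.2)].

(** When [p] is sublinear and dominates the convex cone [D], the linear minorants of this functional
    are exactly the linear [l <= p] with [w.2 <= l w.1] on [D]. *)
Definition lowered p D u := inf [set p (u + w.1) - w.2 | w in D].

Lemma sublinear0 p : sublinear p -> p 0 = 0.
Proof. by move=> [_ h]; rewrite -(scale0r 0) h// mul0r. Qed.

Lemma sublinear_opp p u : sublinear p -> - p (- u) <= p u.
Proof.
by move=> sp; have := sp.1 u (- u); rewrite subrr (sublinear0 sp); lra.
Qed.

Section lowered.
Variables (p : V -> R) (D : set (V * R)).
Hypotheses (sp : sublinear p) (cD : convex_cone D).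
Hypothesis pD : forall w, D w -> w.2 <= p w.1.

Lemma lowered_lbound u : lbound [set p (u + w.1) - w.2 | w in D] (- p (- u)).
Proof.
move=> _ [w Dw <-]; have := sp.1 (- u) (u + w.1).
rewrite addrA addNr add0r => h; have := pD Dw; lra.
Qed.

Lemma lowered_le u w : D w -> lowered p D u <= p (u + w.1) - w.2.
Proof.
move=> Dw; apply: ge_inf; last by exists w.
by exists (- p (- u)); exact: lowered_lbound.
Qed.

Lemma le_lowered u a : (forall w, D w -> a <= p (u + w.1) - w.2) ->
  a <= lowered p D u.
Proof.
move=> h; apply: lb_le_inf; first by exists (p (u + 0) - 0); exists (0, 0) => //; case: cD.
by move=> _ [w Dw <-]; exact: h.
Qed.

Lemma lowered_le_id u : lowered p D u <= p u.
Proof. by have [D0 _ _] := cD; have := lowered_le u D0; rewrite addr0 subr0. Qed.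

Lemma loweredZ_le a u : 0 < a -> a * lowered p D u <= lowered p D (a *: u).
Proof.
move=> a0; apply: le_lowered => w Dw.
have [_ _ DZ] := cD; have ai : 0 <= a^-1 by rewrite invr_ge0 ltW.
have := lowered_le u (DZ a^-1 w ai Dw) => /= h.
have -> : a *: u + w.1 = a *: (u + a^-1 *: w.1).
  by rewrite scalerDr scalerA divff ?gt_eqF// scale1r.
rewrite sp.2 ?(ltW a0)//; have := ler_wpM2l (ltW a0) h.
by rewrite mulrBr mulrA divff ?gt_eqF// mul1r.
Qed.

Lemma sublinear_lowered : sublinear (lowered p D).
Proof.
have [D0 DD DZ] := cD; split=> [u v|a u a0].
  rewrite -lerBlDr; apply: le_lowered => w Dw.
  rewrite lerBlDr -lerBlDl; apply: le_lowered => w' Dw'.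
  have := lowered_le (u + v) (DD _ _ Dw Dw') => /=.
  have := sp.1 (u + w.1) (v + w'.1); rewrite addrACA; lra.
move: a0; rewrite le_eqVlt => /predU1P[<-|a0].
  rewrite scale0r mul0r; apply/eqP; rewrite eq_le; apply/andP; split.
    by rewrite -(sublinear0 sp); exact: lowered_le_id.
  by apply: le_lowered => w Dw; rewrite add0r subr_ge0 pD.
apply/eqP; rewrite eq_le loweredZ_le// andbT.
have ai : 0 < a^-1 by rewrite invr_gt0.
have := loweredZ_le (a *: u) ai.
by rewrite scalerA mulVf ?gt_eqF// scale1r ler_pdivrMl.
Qed.

Lemma lowered_opp w : D w -> lowered p D (- w.1) <= - w.2.
Proof.
move=> Dw; have := lowered_le (- w.1) Dw.
by rewrite addNr (sublinear0 sp) add0r.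
Qed.

End lowered.

Lemma ray_convex_cone (v : V) b :
  convex_cone [set w | exists2 r, 0 <= r & w = (r *: v, r * b)].
Proof.
split=> [|_ _ [r r0 ->] [s s0 ->]|a _ a0 [r r0 ->]] /=.
- by exists 0; rewrite // scale0r mul0r.
- by exists (r + s); rewrite ?addr_ge0// scalerDl mulrDl.
- by exists (a * r); rewrite ?mulr_ge0// scalerA mulrA.
Qed.

(* A sublinear functional that is minimal for the pointwise order is linear:
   otherwise lowering it along the ray of [v] gives a smaller one. *)
Lemma minimal_sublinear_linear q : sublinear q ->
  (forall q', sublinear q' -> (forall u, q' u <= q u) -> forall u, q u <= q' u) ->
  linear (q : V -> R^o).
Proof.
move=> sq qmin.
have qN v : q (- v) = - q v.
  apply/eqP; rewrite eq_le; apply/andP; split; last first.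
    by have := sublinear_opp (- v) sq; rewrite opprK.
  pose D := [set w | exists2 r, 0 <= r & w = (r *: v, r * q v)].
  have cD : convex_cone D := ray_convex_cone v (q v).
  have qD w : D w -> w.2 <= q w.1 by move=> [r r0 ->] /=; rewrite sq.2.
  have h := qmin _ (sublinear_lowered sq cD qD) (lowered_le_id sq cD qD) (- v).
  apply: (le_trans h); apply: (@lowered_opp _ _ sq qD (v, q v)).
  by exists 1 => //; rewrite scale1r mul1r.
have qD u v : q (u + v) = q u + q v.
  have := sq.1 (u + v) (- v); rewrite addrK qN => h.
  by apply/eqP; rewrite eq_le sq.1 -lerBrDr.
move=> a u v; rewrite qD; congr (_ + _).
have [a0|a0] := leP 0 a; first by rewrite sq.2.
by rewrite -[a]opprK scaleNr qN sq.2 ?oppr_ge0 ?(ltW a0)// scaleNr.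
Qed.

(** Zorn's lemma for the reversed pointwise order [Rl]. The infimum over a chain is finite because
    of the bound [- p (- u)], and subadditive because two members of a chain are comparable. *)
Lemma exists_minimal_sublinear p : sublinear p ->
  exists q, [/\ sublinear q, forall u, q u <= p u &
  forall q', sublinear q' -> (forall u, q' u <= q u) -> forall u, q u <= q' u].
Proof.
move=> sp; pose T := {q : V -> R | sublinear q /\ forall u, q u <= p u}.
pose t0 : T := exist _ p (conj sp (fun u => lexx _)).
pose Rl (s t : T) := `[< forall u, sval t u <= sval s u >].
have Tlb (t : T) u : - p (- u) <= sval t u.
  have [st tp] := svalP t; apply: le_trans (sublinear_opp u st).
  by rewrite lerN2.
have [||A totA|t tmax] := @ZL_preorder T t0 Rl.
- by move=> t; apply/asboolP.
- move=> r s t /asboolP rs /asboolP st; apply/asboolP => u.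
  exact: le_trans (st u) (rs u).
- have [[a Aa]|A0] := pselect (exists a, A a); last first.
    by exists t0 => s As; exfalso; apply: A0; exists s.
  pose S u := [set sval t u | t in A].
  have Slb u : has_lbound (S u) by exists (- p (- u)) => _ [t _ <-].
  pose q u := inf (S u).
  have qle (t : T) u : A t -> q u <= sval t u by move=> At; apply: ge_inf => //; exists t.
  have le_q u (b : R) : (forall t, A t -> b <= sval t u) -> b <= q u.
    move=> h; apply: lb_le_inf; first by exists (sval a u); exists a.
    by move=> _ [t At <-]; exact: h.
  have qZ (b : R) u : 0 < b -> b * q u <= q (b *: u).
    move=> b0; apply: (le_q) => t At; rewrite (svalP t).1.2 ?(ltW b0)//.
    by rewrite ler_pM2l// qle.
  have sq : sublinear q.
    split=> [u v|b u].
      rewrite -lerBlDr; apply: (le_q) => s As.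
      rewrite lerBlDr -lerBlDl. apply: (le_q) => t At; rewrite lerBlDl.
      have [/asboolP st|/asboolP ts] := totA _ _ As At.
        apply: le_trans (qle t _ At) _; apply: le_trans ((svalP t).1.1 u v) _.
        by rewrite lerD2r.
      apply: le_trans (qle s _ As) _; apply: le_trans ((svalP s).1.1 u v) _.
      by rewrite lerD2l.
    rewrite le_eqVlt => /predU1P[<-|b0].
      rewrite scale0r mul0r; apply/eqP; rewrite eq_le; apply/andP; split.
        by rewrite (le_trans (qle a _ Aa))// (sublinear0 (svalP a).1).
      by apply: (le_q) => t At; rewrite (sublinear0 (svalP t).1).
    apply/eqP; rewrite eq_le qZ// andbT.
    have bi : 0 < b^-1 by rewrite invr_gt0.
    have := qZ _ (b *: u) bi.
    by rewrite scalerA mulVf ?gt_eqF// scale1r ler_pdivrMl.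
  have qp u : q u <= p u by apply: le_trans (qle a u Aa) ((svalP a).2 u).
  by exists (exist _ q (conj sq qp)) => s As; apply/asboolP => u /=; exact: qle.
- exists (sval t); split; [exact: (svalP t).1|exact: (svalP t).2|].
  move=> q' sq' q't; have q'p u : q' u <= p u by apply: le_trans (q't u) ((svalP t).2 u).
  by have /asboolP := tmax (exist _ q' (conj sq' q'p)) (asboolT q't).
Qed.

(** A minimal sublinear functional below [lowered p D] is linear; its value at [- w.1] then gives
    the constraint at [w]. *)
Theorem mazur_orlicz p D : sublinear p -> convex_cone D ->
    (forall w, D w -> w.2 <= p w.1) ->
  exists l, [/\ linear (l : V -> R^o), forall u, l u <= p u &
                forall w, D w -> w.2 <= l w.1].
Proof.
move=> sp cD pD.
have [l [sl ll lmin]] := exists_minimal_sublinear (sublinear_lowered sp cD pD).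
have linl := minimal_sublinear_linear sl lmin.
exists l; split=> // [u|w Dw].
  by apply: le_trans (ll u) _; exact: lowered_le_id.
have := le_trans (ll (- w.1)) (lowered_opp sp pD Dw).
have -> : l (- w.1) = - l w.1.
  have := linl (-1) w.1 0; rewrite addr0 scaleN1r => ->.
  by rewrite (sublinear0 sl) addr0 scaleN1r.
by rewrite lerN2.
Qed.

Definition convex_subset (K : set V) :=
  forall x y (t : R), K x -> K y -> 0 <= t <= 1 -> K (t *: x + (1 - t) *: y).

(** The constraints are those of the cone generated by the pairs [(k, b)] with [k] in [K]. *)
Corollary mazur_orlicz_convex p (K : set V) b : sublinear p -> convex_subset K ->
    (forall k, K k -> b <= p k) ->
  exists l, [/\ linear (l : V -> R^o), forall u, l u <= p u &
                forall k, K k -> b <= l k].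
Proof.
move=> sp cK bK; have [[k0 Kk0]|K0] := pselect (exists k, K k); last first.
  have [||l [? ? _]] := @mazur_orlicz p [set w | exists2 r, 0 <= r & w = (r *: 0, r * 0)] sp.
  - exact: ray_convex_cone.
  - by move=> _ [r _ ->] /=; rewrite scaler0 mulr0 sublinear0.
  - by exists l; split=> // k Kk; exfalso; apply: K0; exists k.
pose D := [set w : V * R | exists (r : R) k, [/\ 0 <= r, K k & w = (r *: k, r * b)]].
have cD : convex_cone D.
  split=> [|_ _ [r [k [r0 Kk ->]]] [s [k' [s0 Kk' ->]]]|a _ a0 [r [k [r0 Kk ->]]]].
  - by exists 0, k0; rewrite scale0r mul0r.
  (* Nonnegative weights of sum zero are both zero; otherwise dividing by [r + s] exhibits the sum
     as a multiple of a point of [K]. *)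
  - have [rs|rs] := eqVneq (r + s) 0.
      move/eqP: rs; rewrite paddr_eq0// => /andP[/eqP-> /eqP->].
      by exists 0, k0; split=> //; rewrite !scale0r !mul0r; congr pair; rewrite /= addr0.
    have rsp : 0 < r + s by rewrite lt_def rs addr_ge0.
    exists (r + s), ((r / (r + s)) *: k + (1 - r / (r + s)) *: k'); split.
    + exact: addr_ge0.
    + apply: cK => //; rewrite divr_ge0 ?addr_ge0//= ler_pdivrMr// mul1r.
      by rewrite lerDl.
    + have e : 1 - r / (r + s) = s / (r + s) by field.
      rewrite e scalerDr !scalerA !(mulrCA (r + s)) !divff// !mulr1.
      by congr (_, _); rewrite /= -mulrDl.
  - by exists (a * r), k; rewrite mulr_ge0// scalerA mulrA.
have [|l [l1 l2 l3]] := mazur_orlicz sp cD.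
  by move=> _ [r [k [r0 Kk ->]]] /=; rewrite sp.2// ler_wpM2l// bK.
exists l; split=> // k Kk; have := l3 (1 *: k, 1 * b); rewrite /= scale1r mul1r.
by apply; exists 1, k; rewrite scale1r mul1r.
Qed.

End mazur_orlicz.

(** * Dual norm, separation and Goldstine *)

Lemma finite_lower_bound (R : realFieldType) (I : finType) (e : I -> R) :
  (forall i, 0 < e i) -> exists2 b, 0 < b & forall i, b <= e i.
Proof.
move=> e0; exists (\big[Num.min/1]_i e i); last by move=> i; exact: bigmin_le_cond.
by apply: lt_bigmin.
Qed.

Section linear_functionals.
Context {R : realType} {V : lmodType R} (f : V -> R^o).
Hypothesis lf : linear f.

Let lin0 : f 0 = 0 :> R.
Proof. by have := lf (-1) 0 0; rewrite scaler0 addr0 scaleN1r addNr. Qed.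

Lemma linear_scale a x : f (a *: x) = a * f x :> R.
Proof. by have := lf a x 0; rewrite !addr0 lin0 addr0. Qed.

Lemma linear_add x y : f (x + y) = f x + f y :> R.
Proof. by have := lf 1 x y; rewrite !scale1r. Qed.

Lemma linear_zero : f 0 = 0 :> R. Proof. exact: lin0. Qed.

Lemma linear_opp x : f (- x) = - f x :> R.
Proof. by rewrite -scaleN1r linear_scale mulN1r. Qed.

Lemma linear_sub x y : f (x - y) = f x - f y :> R.
Proof. by rewrite linear_add linear_opp. Qed.

Lemma linear_bigsum (I : Type) (r : seq I) (P : pred I) (x : I -> V) :
  f (\sum_(i <- r | P i) x i) = \sum_(i <- r | P i) f (x i) :> R.
Proof. by apply: big_morph; [exact: linear_add|exact: linear_zero]. Qed.

End linear_functionals.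

Section dual_space.
Context {R : realType} {X : normedModType R}.
Implicit Types (f g h : X -> R^o) (x y : X).
Local Notation N := (@dual_norm R X).

Lemma dual_linear f : dual X f -> linear f. Proof. by case. Qed.

Lemma unit_ball0 : unit_ball X 0. Proof. by rewrite /unit_ball/= normr0 ler01. Qed.

Lemma unit_ballN x : unit_ball X x -> unit_ball X (- x).
Proof. by rewrite /unit_ball/= normrN. Qed.

(** A one-sided bound suffices, since it also applies to [- x]; this is the form in which
    Hahn-Banach delivers functionals. *)
Lemma dual_of_bound f c : linear f -> (forall x, f x <= c * `|x|) -> dual X f.
Proof.
move=> lf fc; split=> //.
pose F : {linear X -> R^o} := HB.pack f (GRing.isLinear.Build _ _ _ _ _ lf).
apply: (@bounded_linear_continuous _ _ _ F); apply/bounded_funP => r.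
exists (`|c| * r) => x xr; have cx : c * `|x| <= `|c| * r.
  by apply: le_trans (ler_norm _) _; rewrite normrM normr_id ler_wpM2l.
rewrite ler_norml; apply/andP; split; last exact: le_trans (fc x) cx.
rewrite lerNl; change (- f x <= `|c| * r); rewrite -(linear_opp lf).
by apply: le_trans (fc _) _; rewrite normrN.
Qed.

Lemma dual_bound f : dual X f -> exists2 c, 0 <= c & forall x, `|f x| <= c * `|x|.
Proof.
move=> [lf cf].
pose F : {linear X -> R^o} := HB.pack f (GRing.isLinear.Build _ _ _ _ _ lf).
have : bounded_near F (nbhs 0) by apply/linear_bounded_continuous.
by move/linear_boundedP/pinfty_ex_gt0 => [c c0 h]; exists c => //; exact: ltW.
Qed.

Lemma dual_norm_has_sup f : dual X f -> has_sup [set `|f x| | x in unit_ball X].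
Proof.
move=> /dual_bound[c c0 fc]; split; first by exists `|f 0|; exists 0 => //; exact: unit_ball0.
exists c => _ [x Bx <-]; apply: le_trans (fc x) _.
by rewrite -[leRHS]mulr1 ler_wpM2l.
Qed.

Lemma dual_norm_ubound f x : dual X f -> unit_ball X x -> `|f x| <= N f.
Proof.
by move=> df Bx; apply: ub_le_sup; [exact: (dual_norm_has_sup df).2|exists x].
Qed.

Lemma dual_norm_ge0 f : dual X f -> 0 <= N f.
Proof. by move=> df; apply: le_trans (dual_norm_ubound df unit_ball0). Qed.

Lemma dual_norm_le f c : linear f ->
  (forall x, unit_ball X x -> f x <= c) -> N f <= c.
Proof.
move=> lf fc; apply: ge_sup; first by exists `|f 0|; exists 0 => //; exact: unit_ball0.
move=> _ [x Bx <-]; rewrite ler_norml fc// andbT lerNl.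
by change (- f x <= c); rewrite -(linear_opp lf); exact/fc/unit_ballN.
Qed.

Lemma dual_normP f x : dual X f -> `|f x| <= N f * `|x|.
Proof.
move=> df; have [->|x0] := eqVneq x 0.
  by rewrite (linear_zero (dual_linear df)) !normr0 mulr0.
have nx : 0 < `|x| by rewrite normr_gt0.
have Bx : unit_ball X (`|x|^-1 *: x).
  by rewrite /unit_ball/= normrZ gtr0_norm ?invr_gt0// mulVf ?gt_eqF.
have := dual_norm_ubound df Bx.
rewrite (linear_scale (dual_linear df)) normrM gtr0_norm ?invr_gt0//.
by rewrite mulrC ler_pdivrMr.
Qed.

Lemma dual_le_norm f x : dual X f -> f x <= N f * `|x|.
Proof. by move=> df; apply: le_trans (ler_norm _) (dual_normP x df). Qed.

Lemma dual_norm_lt f e : dual X f -> 0 < e ->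
  exists2 x, unit_ball X x & N f - e < f x.
Proof.
move=> df e0; have [_ [x Bx <-] h] := sup_adherent e0 (dual_norm_has_sup df).
have [fx|fx] := leP 0 (f x : R); first by exists x => //; rewrite ger0_norm in h.
exists (- x); first exact: unit_ballN.
by rewrite ltr0_norm// in h; rewrite (linear_opp (dual_linear df)).
Qed.

Lemma dual0 : dual X (0 : X -> R^o).
Proof.
apply: (@dual_of_bound _ 0) => [a x y|x]; last by rewrite mul0r.
by rewrite /= scaler0 addr0.
Qed.

Lemma dual_comb a f g : dual X f -> dual X g -> dual X (a *: f + g).
Proof.
move=> df dg; apply: (@dual_of_bound _ (`|a| * N f + N g)).
  move=> b x y; change (a * f (b *: x + y) + g (b *: x + y) =
    b * (a * f x + g x) + (a * f y + g y) :> R).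
  rewrite !(linear_add (dual_linear df)) !(linear_add (dual_linear dg)).
  rewrite !(linear_scale (dual_linear df)) !(linear_scale (dual_linear dg)).
  by ring.
move=> x; change (a * f x + g x <= (`|a| * N f + N g) * `|x|).
rewrite mulrDl lerD ?dual_le_norm//.
by apply: le_trans (ler_norm _) _; rewrite normrM -mulrA ler_wpM2l ?dual_normP.
Qed.

Lemma dualD f g : dual X f -> dual X g -> dual X (f + g).
Proof. by move=> df dg; rewrite -[f]scale1r; exact: dual_comb. Qed.

Lemma dualZ a f : dual X f -> dual X (a *: f).
Proof. by move=> df; rewrite -[_ *: _]addr0; apply: dual_comb => //; exact: dual0. Qed.

Lemma dualN f : dual X f -> dual X (- f).
Proof. by move=> df; rewrite -scaleN1r; exact: dualZ. Qed.

Lemma dualB f g : dual X f -> dual X g -> dual X (f - g).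
Proof. by move=> df dg; apply: dualD => //; exact: dualN. Qed.

Lemma dual_sum (I : Type) (r : seq I) (P : pred I) (f : I -> X -> R^o) :
  (forall i, P i -> dual X (f i)) -> dual X (\sum_(i <- r | P i) f i).
Proof. by move=> df; apply: big_ind => //; [exact: dual0|exact: dualD]. Qed.

Lemma dual_norm0 : N 0 = 0.
Proof.
apply/eqP; rewrite eq_le dual_norm_ge0 ?andbT; last exact: dual0.
by apply: dual_norm_le => //; exact: dual_linear dual0.
Qed.

Lemma dual_normD f g : dual X f -> dual X g -> N (f + g) <= N f + N g.
Proof.
move=> df dg; apply: dual_norm_le => [|x Bx]; first exact: dual_linear (dualD df dg).
by apply: lerD; apply: le_trans (ler_norm _) (dual_norm_ubound _ _).
Qed.

Lemma dual_normN f : dual X f -> N (- f) = N f.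
Proof.
move=> df; rewrite /dual_norm; congr (sup _); apply/seteqP; split => _ [x Bx <-];
  by exists x => //; rewrite /= normrN.
Qed.

Lemma dual_normZ a f : dual X f -> N (a *: f) = `|a| * N f.
Proof.
have le b g : dual X g -> N (b *: g) <= `|b| * N g.
  move=> dg; apply: dual_norm_le => [|x Bx]; first exact: dual_linear (dualZ _ dg).
  change (b * g x <= `|b| * N g); apply: le_trans (ler_norm _) _.
  by rewrite normrM ler_wpM2l ?dual_norm_ubound.
move=> df; apply/eqP; rewrite eq_le le//=; have [->|a0] := eqVneq a 0.
  by rewrite normr0 mul0r; exact/dual_norm_ge0/dualZ.
have := le a^-1 _ (dualZ a df); rewrite scalerA mulVf// scale1r normfV.
by rewrite ler_pdivlMl ?normr_gt0.
Qed.

Lemma dual_norm_lipschitz f g : dual X f -> dual X g -> N f - N g <= N (f + g).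
Proof.
move=> df dg; rewrite lerBlDr -(dual_normN dg).
by rewrite -{1}(addrK g f); apply: dual_normD; [exact: dualD|exact: dualN].
Qed.

Lemma dual_norm_eq0 f : dual X f -> N f = 0 -> f = 0.
Proof.
move=> df f0; apply/funext => x; apply/eqP; rewrite -normr_le0.
by have := dual_normP x df; rewrite f0 mul0r.
Qed.

Lemma dual_norm_gt0 f : dual X f -> f <> 0 -> 0 < N f.
Proof.
move=> df f0; rewrite lt_def dual_norm_ge0// andbT; apply/eqP => /(dual_norm_eq0 df).
exact: f0.
Qed.

(** The closed unit ball of the bidual. As [phi] is defined on all maps, linearity and the bound are
    imposed on [dual X] only; the bound at [- f] gives the other side. *)
Definition bidual_ball (phi : (X -> R^o) -> R) :=
  (forall a f g, dual X f -> dual X g -> phi (a *: f + g) = a * phi f + phi g) /\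
  (forall f, dual X f -> phi f <= N f).

Lemma norm_sublinear c : 0 <= c -> sublinear (fun x : X => c * `|x|).
Proof.
move=> c0; split=> [x y|a x a0]; first by rewrite -mulrDr ler_wpM2l// ler_normD.
by rewrite normrZ ger0_norm// mulrCA.
Qed.

(** The translate of [C] by [- y] stays at distance at least [e] from 0, so Mazur-Orlicz applies to
    it with the norm as sublinear functional. *)
Lemma separate_closed_convex (C : set X) y : convex_subset C -> ~ closure C y ->
  exists g e, [/\ dual X g, 0 < e & forall x, C x -> g y + e <= g x].
Proof.
move=> cC ncl.
have [e e0 Ce] : exists2 e, 0 < e & forall x, C x -> e <= `|x - y|.
  apply: contrapT => h; apply: ncl => B /nbhs_ballP[e e0 eB].
  apply: contrapT => CB; apply: h; exists e => // x Cx.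
  rewrite leNgt; apply/negP => xy; apply: CB; exists x; split => //; apply: eB.
  by rewrite -ball_normE/= distrC.
pose K := [set x - y | x in C].
have cK : convex_subset K.
  move=> _ _ t [x Cx <-] [x' Cx' <-] t01; exists (t *: x + (1 - t) *: x'); first exact: cC.
  by rewrite !scalerBr addrACA -opprD -scalerDl subrKC scale1r.
have [_ [x Cx <-]|l [ll lle lK]] := mazur_orlicz_convex (b := e) (norm_sublinear ler01) cK.
  by rewrite mul1r Ce.
exists l, e; split=> // [|x Cx]; first exact: dual_of_bound lle.
by rewrite addrC -lerBrDr -(linear_sub ll); apply: lK; exists x.
Qed.

(** Without such a [y], the sum of positive parts is at least [b] on the convex set of vectors
    [a i + b - h i y]. A linear minorant has weights [w i >= 0], and [G], the sum of the
    [w i *: h i], satisfies [N G < phi G], which is absurd. *)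
Lemma goldstine phi (I : finType) (h : I -> X -> R^o) (a : I -> R) :
    bidual_ball phi -> (forall i, dual X (h i)) -> (forall i, a i < phi (h i)) ->
  exists2 y, unit_ball X y & forall i, a i < h i y.
Proof.
move=> [phil phin] dh ah.
have [b b0 hb] : exists2 b, 0 < b & forall i, b <= phi (h i) - a i.
  by apply: finite_lower_bound => i; rewrite subr_gt0.
apply: contrapT => hno.
have phi0 : phi 0 = 0.
  by have := phil (-1) 0 0 dual0 dual0; rewrite scaler0 addr0 mulN1r addNr.
pose p (t : I -> R^o) : R := \sum_i Num.max (t i : R) 0.
have sp : sublinear p.
  split=> [u v|c u c0].
    rewrite -big_split; apply: ler_sum => i _ /=.
    rewrite ge_max addr_ge0 ?le_max ?lexx ?orbT// andbT.
    by apply: lerD; rewrite le_max lexx.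
  by rewrite mulr_sumr; apply: eq_bigr => i _; rewrite maxr_pMr// mulr0.
pose K := [set (fun i => a i + b - h i y : R^o) | y in unit_ball X].
have cK : convex_subset K.
  move=> _ _ t [y By <-] [z Bz <-] /andP[t0 t1].
  exists (t *: y + (1 - t) *: z).
    apply: le_trans (ler_normD _ _) _; rewrite !normrZ !ger0_norm ?subr_ge0//.
    have : t * `|y| <= t * 1 by rewrite ler_wpM2l.
    have : (1 - t) * `|z| <= (1 - t) * 1 by rewrite ler_wpM2l ?subr_ge0.
    by lra.
  apply/funext => i; change (a i + b - h i (t *: y + (1 - t) *: z) =
    t * (a i + b - h i y) + (1 - t) * (a i + b - h i z) :> R).
  rewrite (linear_add (dual_linear (dh i))) !(linear_scale (dual_linear (dh i))).
  by ring.
have [_ [y By <-]|l [ll lle lK]] := mazur_orlicz_convex (b := b) sp cK.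
  have [i ai] : exists i, h i y <= a i.
    apply: contrapT => hall; apply: hno; exists y => // i.
    by rewrite ltNge; apply/negP => hi; apply: hall; exists i.
  rewrite /p (bigD1 i)//= -[leLHS]addr0 lerD//.
    by rewrite le_max lerBrDr [leRHS]addrC lerD2l ai.
  by apply: sumr_ge0 => j _; rewrite le_max lexx orbT.
pose d i : I -> R^o := fun j => (j == i)%:R.
pose w i : R := l (d i).
(* The sublinear functional [p] vanishes at [- d i]. *)
have w0 i : 0 <= w i.
  rewrite -oppr_le0 /w -(linear_opp ll); apply: le_trans (lle _) _.
  rewrite /p big1// => j _; apply/max_idPr.
  by change (- (j == i)%:R <= 0 :> R); rewrite oppr_le0 ler0n.
have lE t : l t = \sum_i w i * t i.
  have {1}-> : t = \sum_i t i *: d i.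
    apply/funext => j; rewrite fct_sumE (bigD1 j)//= big1 ?addr0.
      by change (t j = t j * (j == j)%:R :> R); rewrite eqxx mulr1.
    move=> i ij; change (t i * (j == i)%:R = 0 :> R).
    by rewrite eq_sym (negbTE ij) mulr0.
  rewrite (linear_bigsum ll); apply: eq_bigr => i _.
  by rewrite (linear_scale ll) mulrC.
pose G : X -> R^o := \sum_i w i *: h i.
have dG : dual X G by apply: dual_sum => i _; exact: dualZ.
have NG : N G <= \sum_i w i * (a i + b) - b.
  apply: dual_norm_le => [|y By]; first exact: dual_linear.
  rewrite lerBrDr -lerBrDl.
  have /= := lK _ (ex_intro2 _ _ y By erefl).
  rewrite lE; move=> /le_trans; apply; rewrite /G fct_sumE -sumrB.
  by under eq_bigr => i _ do rewrite mulrBr.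
have phiG : phi G = \sum_i w i * phi (h i).
  rewrite /G; have H (r : seq I) : phi (\sum_(i <- r) w i *: h i) = \sum_(i <- r) w i * phi (h i).
    elim: r => [|i r IH]; first by rewrite !big_nil.
    rewrite !big_cons phil// ?IH//; apply: dual_sum => j _; exact: dualZ.
  exact: H.
have := phin _ dG; rewrite phiG; apply/negP; rewrite -ltNge.
apply: le_lt_trans NG _; rewrite ltrBlDr ltr_pwDr//.
by apply: ler_sum => i _; rewrite ler_wpM2l// addrC -lerBrDr.
Qed.

End dual_space.

(** * Band projections on the dual of an L1-predual *)

(** The later arguments use these rules without reference to [mu]. In [band_support], [S] is the set
    where the density of [F] is nonzero: inside it, a set null for [F] is null for every functional,
    and on a set that [F] does not split every functional is a multiple of [F]. *)
Record band_projections (R : realType) (X : normedModType R) d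
    (T : measurableType d) (P : set T -> (X -> R^o) -> (X -> R^o)) : Prop := {
  band_dual : forall A f, measurable A -> dual X f -> dual X (P A f);
  band_linear : forall A a f g, measurable A -> dual X f -> dual X g ->
    P A (a *: f + g) = a *: P A f + P A g;
  band_comp : forall A B f, measurable A -> measurable B -> dual X f ->
    P A (P B f) = P (A `&` B) f;
  band_setT : forall f, dual X f -> P setT f = f;
  band_setU : forall A B f, measurable A -> measurable B -> dual X f ->
    A `&` B = set0 -> P (A `|` B) f = P A f + P B f;
  band_normU : forall A B f, measurable A -> measurable B -> dual X f ->
    A `&` B = set0 ->
    dual_norm (P (A `|` B) f) = dual_norm (P A f) + dual_norm (P B f);
  band_cvg : forall (F : (set T)^nat) f, nondecreasing_seq F ->
    (forall i, measurable (F i)) -> dual X f ->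
    dual_norm (P (F i) f) @[i --> \oo] --> dual_norm (P (\bigcup_i F i) f);
  band_support : forall F, dual X F -> exists S, [/\ measurable S, P S F = F,
    forall A g, measurable A -> A `<=` S -> dual X g -> P A F = 0 -> P A g = 0 &
    forall A g, measurable A -> A `<=` S -> dual X g ->
      (forall B, measurable B -> B `<=` A -> P B F = 0 \/ P (A `\` B) F = 0) ->
      exists c : R, P A g = c *: P A F] }.

Section L1_predual_projections.
Context {R : realType} {X : normedModType R} {d : measure_display}
  {T : measurableType d} {mu : {measure set T -> \bar R}}.
Variable J : (X -> R^o) -> LspaceType1 mu.
Hypothesis hJ : isometric_dual_L1 J.
Implicit Types (f g h : X -> R^o) (A B : set T) (u : T -> R).
Local Notation N := (@dual_norm R X).

Let L f : T -> R := J f.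

Let mL f : measurable_fun setT (L f).
Proof. exact: (measurable_funPT (repr (J f : {mfun_ mu, T >-> measurableTypeR R}))). Qed.

Let integral_abs0 A u : measurable A -> measurable_fun A u ->
  (\int[mu]_(t in A) `|u t|%:E)%E = 0%:E <-> u = cst 0 %[ae mu in A].
Proof.
move=> mA /measurable_EFinP mu_.
have H := @ae_eq_integral_abs _ _ _ mu A mA (EFin \o u) mu_.
split=> h; first by move/H : h; apply: filterS => t ht At; have [] := ht At.
by apply/H; apply: filterS h => t ht At; rewrite /= ht.
Qed.

Let NE f : dual X f -> ((N f)%:E = \int[mu]_t `|L f t|%:E)%E.
Proof. by case: hJ => _ _ h /h <-; rewrite Lnorm1. Qed.

Let iL f : dual X f -> mu.-integrable setT (EFin \o L f).
Proof.
move=> df; apply/integrableP; split; first exact/measurable_EFinP.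
by rewrite -(NE df) ltry.
Qed.

Let L_lin a f g : dual X f -> dual X g ->
  L (a *: f + g) = (fun t => a * L f t + L g t) %[ae mu].
Proof. by case: hJ => _ h _; exact: h. Qed.

Let L_inj f g : dual X f -> dual X g -> L f = L g %[ae mu] -> f = g.
Proof.
move=> df dg fg; have dh : dual X (-1 *: f + g) by exact: dual_comb.
have h0 : L (-1 *: f + g) = cst 0 %[ae mu].
  move: (L_lin (-1) df dg) fg; apply: filterS2 => t h1 h2 _.
  by rewrite h1// h2// mulN1r addNr.
have : N (-1 *: f + g) = 0.
  apply: EFin_inj; rewrite NE//.
  by apply/integral_abs0.
move/(dual_norm_eq0 dh) => h1; apply/funext => x.
have := congr1 (fun k => k x : R) h1; rewrite scaleN1r => h2.
change (- f x + g x = 0 :> R) in h2; apply/eqP; rewrite -subr_eq0 -oppr_eq0.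
by rewrite opprB addrC; apply/eqP.
Qed.

(** The representative chosen in the class of [u] agrees with [u] only almost everywhere, so
    finiteness of its norm is first transferred from [u]. *)
Let L_surj u : measurable_fun setT u -> mu.-integrable setT (EFin \o u) ->
  exists2 h, dual X h & L h = u %[ae mu].
Proof.
move=> mu_ iu.
have mu' : @measurable_fun _ _ T (measurableTypeR R) setT u by exact: mu_.
pose u0 : {mfun T >-> measurableTypeR R} :=
  HB.pack (u : T -> measurableTypeR R)
    (@isMeasurableFun.Build _ _ T (measurableTypeR R) u mu').
pose q : {mfun_ mu, T >-> measurableTypeR R} := (\pi_{mfun_ mu, T >-> measurableTypeR R} u0)%qT.
have qu : (q : T -> R) = u %[ae mu].
  have : (repr q = u0 %[mod {mfun_ mu, T >-> measurableTypeR R}])%qT by rewrite reprK.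
  by move/eqP; rewrite eqmodE => /asboolP.
have fq : finite_norm mu 1 q.
  rewrite /finite_norm Lnorm1; have /integrableP[_] := iu.
  apply: le_lt_trans; rewrite le_eqVlt; apply/orP; left; apply/eqP.
  apply: ae_eq_integral => //.
  - by apply/measurable_EFinP/measurableT_comp => //; exact: measurable_funP.
  - by apply/measurable_EFinP/measurableT_comp.
  - by apply: filterS qu => t h _; rewrite /= h.
pose q' : LspaceType1 mu := HB.pack q (isFinLebesgue.Build _ _ _ _ _ _ q fq).
case: hJ => [[_ _ sJ] _ _]; have [h dh hq] := sJ q' I.
by exists h => //; rewrite /L hq.
Qed.

(** The functional whose density is that of [f] cut off outside [A]. The default 0 is not reached
    when [A] is measurable and [f] is in the dual. *)
Let P A f : X -> R^o :=
  xget (0 : X -> R^o) [set h | dual X h /\ L h = (fun t => \1_A t * L f t) %[ae mu]].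

Let P_spec A f : measurable A -> dual X f ->
  dual X (P A f) /\ L (P A f) = (fun t => \1_A t * L f t) %[ae mu].
Proof.
move=> mA df.
have mu1 : measurable_fun setT (fun t => \1_A t * L f t).
  by apply: measurable_funM => //; exact: measurable_indic.
have [|h dh hu] := L_surj mu1; last first.
  by apply: (@xgetPex _ 0 [set h | dual X h /\ L h = (fun t => \1_A t * L f t) %[ae mu]]); exists h.
apply: (le_integrable measurableT _ _ (iL df)); first exact/measurable_EFinP.
move=> t _; rewrite /= lee_fin normrM indicE; case: (_ \in _).
  by rewrite normr1 mul1r.
by rewrite normr0 mul0r.
Qed.

Let P_dual A f : measurable A -> dual X f -> dual X (P A f).
Proof. by move=> mA df; have [] := P_spec mA df. Qed.

Let P_uniq A f h : measurable A -> dual X f -> dual X h ->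
  L h = (fun t => \1_A t * L f t) %[ae mu] -> h = P A f.
Proof.
move=> mA df dh hu; have [dP Pu] := P_spec mA df; apply: L_inj => //.
by move: hu Pu; apply: filterS2 => t h1 h2 _; rewrite h1// h2.
Qed.

Let N_P A f : measurable A -> dual X f ->
  ((N (P A f))%:E = \int[mu]_(t in A) `|L f t|%:E)%E.
Proof.
move=> mA df; have [dP Pu] := P_spec mA df; rewrite NE// [RHS]integral_mkcond.
apply: ae_eq_integral => //.
- by apply/measurable_EFinP/measurableT_comp.
- by apply/(measurable_restrictT _ mA)/measurable_EFinP/measurable_funTS/measurableT_comp.
apply: filterS Pu => t h _; rewrite /= h// patchE indicE.
by case: ifPn; rewrite ?mul1r ?mul0r ?normr0.
Qed.

Let P_eq0 A f : measurable A -> dual X f -> P A f = 0 -> L f = cst 0 %[ae mu in A].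
Proof.
move=> mA df P0; have := N_P mA df; rewrite P0 dual_norm0 => /esym.
by move/integral_abs0 => /(_ mA (measurable_funTS (mL f))).
Qed.

Let P_ae0 A f : measurable A -> dual X f -> L f = cst 0 %[ae mu in A] -> P A f = 0.
Proof.
move=> mA df f0; apply: dual_norm_eq0; first exact: P_dual.
apply: EFin_inj; rewrite N_P//; apply/integral_abs0 => //.
exact: measurable_funTS.
Qed.

(* The constant is found by making the integral of [u - c |L F|] over [A]
   vanish: this difference has a constant sign on [A], so it is zero. *)
Let atom_constant F A g : dual X F -> measurable A -> dual X g ->
    P A F <> 0 ->
    (forall B, measurable B -> B `<=` A ->
      {ae mu, forall t, ~ B t} \/ {ae mu, forall t, ~ (A `\` B) t}) ->
  exists c, L g = (fun t => c * `|L F t|) %[ae mu in A].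
Proof.
move=> dF mA dg PF hA.
have iF : mu.-integrable A (EFin \o (fun t => `|L F t|)).
  by apply: (integrableS measurableT) => //; exact: (integrable_norm (iL dF)).
have ig : mu.-integrable A (EFin \o L g) by exact: (integrableS measurableT _ _ (iL dg)).
pose c := (\int[mu]_(t in A) L g t) / (\int[mu]_(t in A) `|L F t|).
have F0 : \int[mu]_(t in A) `|L F t| != 0.
  by rewrite /Rintegral -N_P//; apply/eqP => /(dual_norm_eq0 (P_dual mA dF)).
pose u t := L g t - c * `|L F t|.
have icF : mu.-integrable A (EFin \o (fun t => c * `|L F t|)).
  by rewrite (_ : _ \o _ = (fun t => c%:E * (`|L F t|)%:E)%E)//;
    exact: integrableZl.
have iu : mu.-integrable A (EFin \o u) by exact: (integrableB mA ig icF).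
have mu0 : measurable_fun setT u.
  apply: measurable_funB => //; apply: measurable_funM => //.
  exact: measurableT_comp.
have u0 : (\int[mu]_(t in A) (u t)%:E = 0)%E.
  rewrite -(@fineK _ (\int[mu]_(t in A) (u t)%:E)%E); last exact: integrable_fin_num.
  congr EFin; change (\int[mu]_(t in A) (L g t - c * `|L F t|) = 0).
  by rewrite RintegralB// RintegralZl// /c divfK// subrr.
exists c; suff : u = cst 0 %[ae mu in A].
  by apply: filterS => t h At; apply/eqP; rewrite -subr_eq0; apply/eqP/(h At).
apply/integral_abs0 => //; first exact: measurable_funTS.
have mB : measurable (A `&` [set t | 0 < u t]).
  by apply: measurable_fun_ltr => //; apply: measurable_funTS.
have abs_eq (s : R) : `|s| = 1 -> {ae mu, forall t, A t -> `|u t| = s * u t} ->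
    (\int[mu]_(t in A) `|u t|%:E)%E = 0%:E.
  move=> s1 h; transitivity (s%:E * 0)%E; last by rewrite mule0.
  rewrite -u0 -integralZl//; apply: ae_eq_integral => //.
  - exact/measurable_EFinP/measurable_funTS/measurableT_comp.
  - exact/measurable_EFinP/measurable_funTS/measurable_funM.
  - by apply: filterS h => t ht At; rewrite ht.
have [h|h] := hA _ mB (@subIsetl _ _ _).
- apply: (abs_eq (-1)); first by rewrite normrN1.
  apply: filterS h => t ht At; rewrite mulN1r ler0_norm// leNgt; apply/negP => ut.
  by apply: ht.
- apply: (abs_eq 1); first by rewrite normr1.
  apply: filterS h => t ht At; rewrite mul1r ger0_norm// leNgt; apply/negP => ut.
  by apply: ht; split=> // -[_] /=; rewrite ltNge (ltW ut).
Qed.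

Let supp f : set T := [set t | L f t != 0].

Let measurable_supp f : measurable (supp f).
Proof.
rewrite (_ : supp f = ~` (setT `&` L f @^-1` [set 0])).
  by apply: measurableC; apply: mL => //; exact: measurable_set1.
apply/seteqP; split=> t /=; first by move=> /eqP h [_ /h].
by move=> h; apply/eqP => h0; apply: h.
Qed.

Let P_supp_negligible f A : dual X f -> measurable A -> A `<=` supp f ->
  P A f = 0 -> {ae mu, forall t, ~ A t}.
Proof.
move=> df mA As /(P_eq0 mA df); apply: filterS => t h At.
by have /eqP := As t At; apply; exact: h.
Qed.

Lemma exists_band_projections :
  exists P0 : set T -> (X -> R^o) -> (X -> R^o), band_projections P0.
Proof.
exists P; split.
- exact: P_dual.
- move=> A a f g mA df dg; have dfg : dual X (a *: f + g) by exact: dual_comb.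
  have [dPf Pf] := P_spec mA df; have [dPg Pg] := P_spec mA dg.
  apply/esym/P_uniq => //; first exact: dual_comb.
  have K : {ae mu, forall t, L (a *: P A f + P A g) t = \1_A t * (a * L f t + L g t)}.
    move: Pf Pg (L_lin a dPf dPg); apply: filterS3 => t h1 h2 h3.
    by rewrite h3// h1// h2//; ring.
  by move: K (L_lin a df dg); apply: filterS2 => t h1 h2 _; rewrite h1 h2.
- move=> A B f mA mB df; have [dPf Pf] := P_spec mB df.
  have [dPPf PPf] := P_spec mA dPf; apply: P_uniq => //; first exact: measurableI.
  move: Pf PPf; apply: filterS2 => t h1 h2 _.
  by rewrite h2// h1// indicI/= mulrA.
- move=> f df; apply/esym/P_uniq => //.
  by apply: aeW => t _; rewrite indicT mul1r.
- move=> A B f mA mB df AB.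
  have [dPA PA] := P_spec mA df; have [dPB PB] := P_spec mB df.
  apply/esym/P_uniq => //; [exact: measurableU|exact: dualD|].
  move: PA PB (L_lin 1 dPA dPB); apply: filterS3 => t h1 h2 h3 _.
  move: (h3 I); rewrite scale1r => ->; rewrite mul1r h1// h2// -mulrDl; congr (_ * _).
  rewrite !indicE in_setU; case: (boolP (t \in A)) => tA; last by rewrite add0r.
  case: (boolP (t \in B)) => tB; last by rewrite addr0.
  have : (A `&` B) t by split; [exact: set_mem tA|exact: set_mem tB].
  by rewrite AB.
- move=> A B f mA mB df AB; apply: EFin_inj; rewrite EFinD !N_P//; last exact: measurableU.
  rewrite ge0_integral_setU//; last by rewrite disj_set2E; apply/eqP.
  by apply/measurable_EFinP/measurable_funTS/measurableT_comp.
- move=> F f ndF mF df; apply: (@fine_cvg _ _ _ _ (fun i => (N (P (F i) f))%:E)).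
  rewrite N_P//; last exact: bigcup_measurable.
  rewrite (_ : (fun i => _) = (fun i => \int[mu]_(t in F i) `|L f t|%:E)%E).
    apply: ge0_nondecreasing_set_cvg_integral => // i.
    by apply/measurable_EFinP/measurable_funTS/measurableT_comp.
  by apply/funext => i; rewrite N_P.
- move=> F dF; exists (supp F); split => //.
  + apply/esym/P_uniq => //; apply: aeW => t _; rewrite indicE.
    case: (boolP (t \in supp F)) => [|/negP tS]; first by rewrite mul1r.
    rewrite mul0r; apply/eqP; apply: contrapT => /negP h; apply: tS.
    exact/mem_set.
  + move=> A g mA AS dg PF; apply: P_ae0 => //.
    by apply: filterS (P_supp_negligible dF mA AS PF) => t h /h.
  + move=> A g mA AS dg hA; have [PF|PF] := pselect (P A F = 0).
      exists 0; rewrite scale0r; apply: P_ae0 => //.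
      by apply: filterS (P_supp_negligible dF mA AS PF) => t h /h.
    have hA' B : measurable B -> B `<=` A ->
        {ae mu, forall t, ~ B t} \/ {ae mu, forall t, ~ (A `\` B) t}.
      move=> mB BA; have [h|h] := hA B mB BA; [left|right].
        exact: P_supp_negligible dF mB (subset_trans BA AS) h.
      apply: P_supp_negligible dF (measurableD mA mB) _ h.
      by apply: subset_trans AS; exact: subDsetl.
    (* On [A] both [g] and [F] have densities proportional to that of [|F|], and the factor [c'] of
       [F] is nonzero; hence the ratio [c / c']. *)
    have [c cg] := atom_constant dF mA dg PF hA'.
    have [c' cF] := atom_constant dF mA dF PF hA'.
    have c'0 : c' != 0.
      apply/eqP => c0; apply: PF; apply: P_ae0 => //.
      by apply: filterS cF => t h At; rewrite h// c0 mul0r.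
    exists (c / c'); have [dPF LPF] := P_spec mA dF.
    apply/esym/P_uniq => //; first exact: dualZ.
    have L0 : L 0 = cst 0 %[ae mu].
      apply/integral_abs0 => //; rewrite -NE ?dual_norm0//; exact: dual0.
    have K : {ae mu, forall t, L ((c / c') *: P A F) t = c / c' * (\1_A t * L F t)}.
      move: LPF L0 (L_lin (c / c') dPF dual0); apply: filterS3 => t h1 h2.
      by rewrite addr0 => ->//; rewrite h1// h2// addr0.
    move: K cg cF; apply: filterS3 => t h0 h1 h2 _; rewrite h0 !indicE.
    case: (boolP (t \in A)) => [/set_mem At|_]; last by rewrite !mul0r mulr0.
    by rewrite !mul1r h1// [in LHS]h2// mulrA divfK.
Qed.

End L1_predual_projections.

(** * Exhaustion, atoms and the diffuse alternative *)

(** A finite measure with real values, countable additivity being expressed as continuity from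
    below. *)
Record finite_weight (R : realType) d (T : measurableType d) (nu : set T -> R)
    : Prop := {
  weight_ge0 : forall A, measurable A -> 0 <= nu A;
  weightU : forall A B, measurable A -> measurable B -> A `&` B = set0 ->
    nu (A `|` B) = nu A + nu B;
  weight_cvg : forall F : (set T)^nat, nondecreasing_seq F ->
    (forall i, measurable (F i)) -> nu (F i) @[i --> \oo] --> nu (\bigcup_i F i) }.

Section finite_weight_theory.
Context {R : realType} {d : measure_display} {T : measurableType d}
  {nu : set T -> R}.
Hypothesis hnu : finite_weight nu.
Implicit Types A B G : set T.

Lemma weightD A B : measurable A -> measurable B -> B `<=` A ->
  nu A = nu B + nu (A `\` B).
Proof.
move=> mA mB BA; rewrite -(weightU hnu)//; [|exact: measurableD|exact: setDIK].
by rewrite setDUK.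
Qed.

Lemma weight_le A B : measurable A -> measurable B -> B `<=` A -> nu B <= nu A.
Proof.
by move=> mA mB BA; rewrite (weightD mA mB BA) lerDl weight_ge0//; exact: measurableD.
Qed.

(** Finite unions [G n] of members of [Q] approach the supremum of the weights. A rest of positive
    weight outside their union would contain a member of [Q] disjoint from every [G n], and adding
    it would exceed the supremum. Continuity from below then selects one [G n]. *)
Lemma weight_exhaustion (Q : set (set T)) B e :
    Q set0 -> (forall A A', Q A -> Q A' -> Q (A `|` A')) ->
    (forall A, Q A -> measurable A) -> measurable B ->
    (forall A, measurable A -> A `<=` B -> 0 < nu A ->
      exists A', [/\ Q A', A' `<=` A & 0 < nu A']) ->
    0 < e ->
  exists G, [/\ Q G, G `<=` B & nu (B `\` G) < e].
Proof.
move=> Q0 QU Qm mB Qpos e0.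
pose S := [set nu G | G in [set G | Q G /\ G `<=` B]].
have Sub G : Q G -> G `<=` B -> nu G <= sup S.
  move=> QG GB; apply: ub_le_sup; last by exists G.
  by exists (nu B) => _ [G' [QG' GB'] <-]; apply: weight_le => //; exact: Qm.
have hS : has_sup S.
  split; first by exists (nu set0); exists set0 => //; split.
  by exists (nu B) => _ [G' [QG' GB'] <-]; apply: weight_le => //; exact: Qm.
have /choice[G' hG'] : forall n : nat,
    exists G, [/\ Q G, G `<=` B & sup S - n.+1%:R^-1 < nu G].
  move=> n; have n0 : 0 < n.+1%:R^-1 :> R by rewrite invr_gt0.
  by have [_ [G [QG GB] <-] h] := sup_adherent n0 hS; exists G.
pose G n := \big[setU/set0]_(i < n.+1) G' i.
have QG n : Q (G n).
  by apply: big_ind => // i _; have [h _ _] := hG' i.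
have GB n : G n `<=` B.
  move=> t; rewrite /G -bigcup_mkord => -[i _]; have [_ h _] := hG' i; exact: h.
have nG n : sup S - n.+1%:R^-1 < nu (G n).
  have [Qn nB h] := hG' n; apply: lt_le_trans h _.
  apply: weight_le; [exact: Qm|exact: Qm|].
  by move=> t Gt; rewrite /G big_ord_recr /=; right.
have mG n : measurable (G n) by exact: Qm.
pose U := \bigcup_n G n.
have mU : measurable U by exact: bigcup_measurable.
have UB : U `<=` B by move=> t [n _ /GB].
have R0 : nu (B `\` U) = 0.
  apply/eqP; rewrite eq_le weight_ge0 ?andbT//; last exact: measurableD.
  rewrite leNgt; apply/negP => /Qpos[||A [QA AB A0]]; [exact: measurableD|exact: subDsetl|].
  have bound n : nu A < n.+1%:R^-1.
    have AG : G n `&` A = set0.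
      by apply/seteqP; split=> // t [Gt /AB[_]]; apply; exists n.
    have : nu (G n `|` A) <= sup S.
      apply: Sub; first exact: QU.
      by move=> t [/GB//|/AB[]].
    rewrite (weightU hnu)//; last exact: Qm.
    have := nG n; rewrite ltrBlDr => h1 h2.
    by have := le_lt_trans h2 h1; rewrite ltrD2l.
  have [n hn] : exists n, n.+1%:R^-1 < nu A.
    exists (Num.truncn (nu A)^-1); rewrite invf_plt ?posrE//.
    exact: truncnS_gt.
  by have := bound n; rewrite ltNge (ltW hn).
have ndG : nondecreasing_seq G.
  apply/nondecreasing_seqP => n; rewrite subsetEset /G [X in _ `<=` X]big_ord_recr /=.
  by move=> t; left.
have /cvgrPdist_lt/(_ _ e0)[n _ hn] := weight_cvg hnu ndG mG.
have {hn} := hn n (leqnn n); rewrite -/U => hn.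
exists (G n); split => //.
have := weightD mB mU UB; have := weightD mB (mG n) (GB n); rewrite R0.
have := ler_norm (nu U - nu (G n)); lra.
Qed.

(** A set is split repeatedly, keeping each time a piece of at most half the weight. *)
Lemma small_weight_subset B (e : R) :
    (forall A, measurable A -> A `<=` B -> 0 < nu A ->
      exists A', [/\ measurable A', A' `<=` A, 0 < nu A' & 0 < nu (A `\` A')]) ->
    0 < e -> forall A, measurable A -> A `<=` B -> 0 < nu A ->
  exists A', [/\ measurable A', A' `<=` A & 0 < nu A' < e].
Proof.
move=> hB e0 A mA AB A0.
have halve n : exists A', [/\ measurable A', A' `<=` A & 0 < nu A' <= nu A * 2^-1 ^+ n].
  elim: n => [|n [A1 [mA1 A1A /andP[A10 h]]]]; first by exists A; split=> //; rewrite expr0 mulr1 A0 lexx.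
  have [A2 [mA2 A21 A20 D0]] := hB A1 mA1 (subset_trans A1A AB) A10.
  have mD := measurableD mA1 mA2.
  have := weightD mA1 mA2 A21; rewrite exprSr mulrA => hD.
  have [le|le] := leP (nu A2) (nu A1 * 2^-1).
    exists A2; split=> //; first exact: subset_trans A1A.
    by rewrite A20 (le_trans le)// ler_wpM2r// invr_ge0.
  exists (A1 `\` A2); split=> //; first by apply: subset_trans A1A; exact: subDsetl.
  rewrite D0 /=; apply: (@le_trans _ _ (nu A1 * 2^-1)); first lra.
  by rewrite ler_wpM2r// invr_ge0.
have [n hn] : exists n, nu A * 2^-1 ^+ n < e.
  have : (fun n => nu A * 2^-1 ^+ n : R) @ \oo --> (0 : R).
    rewrite -(mulr0 (nu A)); apply: cvgMr; apply: cvg_expr.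
    by rewrite ger0_norm ?invr_ge0// invf_lt1// ltr1n.
  move/cvgrPdist_lt => /(_ _ e0)[n _ hn]; exists n.
  have := hn n (leqnn n); rewrite sub0r normrN => hn'.
  exact: le_lt_trans (ler_norm _) hn'.
have [A' [mA' A'A /andP[A'0 h]]] := halve n.
by exists A'; split=> //; rewrite A'0 (le_lt_trans h hn).
Qed.

Lemma weight_sum (I : Type) (r : seq I) (nus : I -> set T -> R) :
  (forall i, finite_weight (nus i)) -> finite_weight (fun A => \sum_(i <- r) nus i A).
Proof.
move=> h; split=> [A mA|A B mA mB AB|F ndF mF].
- by apply: sumr_ge0 => i _; exact: weight_ge0.
- by rewrite -big_split; apply: eq_bigr => i _; exact: weightU.
- elim: r => [|i r IH].
    rewrite big_nil; under eq_fun do rewrite big_nil; exact: cvg_cst.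
  rewrite big_cons; under eq_fun do rewrite big_cons.
  by apply: cvgD => //; exact: weight_cvg.
Qed.

End finite_weight_theory.

Section band_projection_theory.
Context {R : realType} {X : normedModType R} {d : measure_display}
  {T : measurableType d} {P : set T -> (X -> R^o) -> (X -> R^o)}.
Hypothesis hP : band_projections P.
Implicit Types (f g h : X -> R^o) (A B : set T).
Local Notation N := (@dual_norm R X).

Lemma band_weight f : dual X f -> finite_weight (fun A => N (P A f)).
Proof.
move=> df; split=> [A mA|A B mA mB AB|F ndF mF].
- exact/dual_norm_ge0/(band_dual hP).
- exact: (band_normU hP).
- exact: (band_cvg hP).
Qed.

Lemma band_set0 f : dual X f -> P set0 f = 0.
Proof.
move=> df; have := band_setU hP measurable0 measurable0 df (set0I _).
by rewrite set0U => /eqP; rewrite -subr_eq0 opprD addrA subrr sub0r oppr_eq0 => /eqP.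
Qed.

Lemma bandZ A a f : measurable A -> dual X f -> P A (a *: f) = a *: P A f.
Proof.
move=> mA df; have P0 : P A 0 = 0.
  have := band_linear hP (-1) mA dual0 dual0.
  by rewrite scaler0 addr0 scaleN1r addNr.
by have := band_linear hP a mA df dual0; rewrite P0 !addr0.
Qed.

Lemma bandD A f g : measurable A -> dual X f -> dual X g -> P A (f + g) = P A f + P A g.
Proof. by move=> mA df dg; have := band_linear hP 1 mA df dg; rewrite !scale1r. Qed.

Lemma band_sum A (I : Type) (r : seq I) (a : I -> R) (f : I -> X -> R^o) :
  measurable A -> (forall i, dual X (f i)) ->
  P A (\sum_(i <- r) a i *: f i) = \sum_(i <- r) a i *: P A (f i).
Proof.
move=> mA df; elim: r => [|i r IH].
  by rewrite !big_nil; have := bandZ 0 mA dual0; rewrite !scale0r.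
rewrite !big_cons (band_linear hP)//; last by apply: dual_sum => j _; exact: dualZ.
by rewrite IH.
Qed.

Lemma band_setD A B f : measurable A -> measurable B -> B `<=` A -> dual X f ->
  P A f = P B f + P (A `\` B) f.
Proof.
move=> mA mB BA df; rewrite -(band_setU hP)//; [|exact: measurableD|exact: setDIK].
by rewrite setDUK.
Qed.

Lemma band_normD A B f : measurable A -> measurable B -> B `<=` A -> dual X f ->
  N (P A f) = N (P B f) + N (P (A `\` B) f).
Proof. by move=> mA mB BA df; exact: (weightD (band_weight df)). Qed.

Lemma band_setC A f : measurable A -> dual X f -> f = P A f + P (~` A) f.
Proof.
move=> mA df; rewrite -{1}(band_setT hP df) -setTD.
exact: band_setD.
Qed.

Lemma band_normC A f : measurable A -> dual X f -> N f = N (P A f) + N (P (~` A) f).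
Proof.
move=> mA df; rewrite -{1}(band_setT hP df) -setTD.
exact: band_normD.
Qed.

Lemma band_norm_le A B f : measurable A -> measurable B -> B `<=` A -> dual X f ->
  N (P B f) <= N (P A f).
Proof. by move=> mA mB BA df; exact: (weight_le (band_weight df)). Qed.

Lemma band_contract A f : measurable A -> dual X f -> N (P A f) <= N f.
Proof.
by move=> mA df; rewrite -{2}(band_setT hP df); exact: band_norm_le.
Qed.

Lemma band_subset A B f : measurable A -> measurable B -> B `<=` A -> dual X f ->
  P B (P A f) = P B f.
Proof. by move=> mA mB BA df; rewrite (band_comp hP)// setIidl. Qed.

Lemma band_subset' A B f : measurable A -> measurable B -> B `<=` A -> dual X f ->
  P A (P B f) = P B f.
Proof. by move=> mA mB BA df; rewrite (band_comp hP)// setIidr. Qed.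

Lemma band_gt0 A f : measurable A -> dual X f -> P A f <> 0 -> 0 < N (P A f).
Proof. by move=> mA df; apply: dual_norm_gt0; exact: (band_dual hP). Qed.

Definition band_atom A :=
  measurable A /\ exists2 e, dual X e & forall g, dual X g -> exists c : R, P A g = c *: e.

Definition atomic_dual := forall F A, dual X F -> measurable A -> 0 < N (P A F) ->
  exists A', [/\ band_atom A', A' `<=` A & 0 < N (P A' F)].

(** The fourth clause is absolute continuity of every functional with respect to [F] on [B]; the
    last says that [F] has no atom there. *)
Definition diffuse F B := [/\ dual X F, measurable B, 0 < N (P B F),
  forall A g, measurable A -> A `<=` B -> dual X g -> P A F = 0 -> P A g = 0 &
  forall A, measurable A -> A `<=` B -> 0 < N (P A F) ->
    exists A', [/\ measurable A', A' `<=` A, 0 < N (P A' F) & 0 < N (P (A `\` A') F)]].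

(** If [A] has positive weight for [F] but no atom inside it has, then [F] is diffuse on the part of
    [A] in its support: by [band_support], a subset that [F] does not split would be such an
    atom. *)
Lemma atomic_or_diffuse : atomic_dual \/ exists F B, diffuse F B.
Proof.
have [|h] := pselect atomic_dual; first by left.
right; apply: contrapT => hd; apply: h => F A dF mA A0.
apply: contrapT => hA; apply: hd.
have [S [mS SF S0 Sat]] := band_support hP dF.
have mAS := measurableI _ _ mA mS.
exists F, (A `&` S); split=> //.
- by rewrite -(band_comp hP)// SF.
- by move=> D g mD DAS; apply: S0 => // t /DAS[].
- move=> D mD DAS D0; apply: contrapT => hD; apply: hA; exists D; split=> //; last first.
    by move=> t /DAS[].
  split=> //; exists (P D F); first exact: (band_dual hP).
  move=> g dg; apply: Sat => //; first by move=> t /DAS[].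
  move=> D' mD' D'D; have [|h1] := pselect (P D' F = 0); first by left.
  right; apply: contrapT => h2; apply: hD; exists D'; split=> //; first exact: band_gt0.
  by apply: band_gt0 => //; exact: measurableD.
Qed.

Lemma band_atom_subset A A' : band_atom A -> measurable A' -> A' `<=` A -> band_atom A'.
Proof.
move=> [mA [e de h]] mA' A'A; split=> //; exists (P A' e); first exact: (band_dual hP).
move=> g dg; have [c hc] := h g dg; exists c.
by rewrite -(band_subset mA)// hc bandZ.
Qed.

End band_projection_theory.

Arguments band_atom {R X d T} P A.
Arguments atomic_dual {R X d T} P.
Arguments diffuse {R X d T} P F B.

(** * Weak neighbourhoods and perturbation of convex combinations *)

Section weak_topology_theory.
Context {R : realType} {X : normedModType R}.

Lemma weak_open_preimage (e : X -> R^o) (U : set R^o) : dual X e -> open U ->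
  open (e @^-1` U : set (weak_topology X)).
Proof.
move=> de oU; rewrite openE => y Uy.
pose i : dual X := SigSub (mem_set de).
pose Tc (f : dual X) := Topological.class (initial_topology (set_val f : X -> R^o)).
have FF : Filter (nbhs (y : weak_topology X)) by exact: nbhs_filter.
have H := (@cvg_sup X (dual X) Tc (nbhs (y : weak_topology X)) y FF).1 (fun A h => h) i.
apply: H; apply: (open_nbhs_nbhs (p := (y : initial_topology e))).
split; last exact: Uy.
by exists U.
Qed.

(** The finite systems of conditions generate a filter converging to [x] in each initial topology,
    hence in their supremum. *)
Lemma weak_open_basis (V : set (weak_topology X)) (x : X) : open V -> V x ->
  exists (I : finType) (g : I -> X -> R^o) (e : R), [/\ forall i, dual X (g i),
    0 < e & forall y, (forall i, `|g i (y - x)| < e) -> V y].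
Proof.
move=> oV Vx.
pose F : set_system X := fun A => exists (I : finType) (g : I -> X -> R^o) (e : R),
  [/\ forall i, dual X (g i), 0 < e & forall y, (forall i, `|g i (y - x)| < e) -> A y].
have FF : Filter F.
  split.
  - by exists void, (fun _ => 0), 1; split=> //; case.
  - move=> A B [I [g [e [dg e0 hA]]]] [I' [g' [e' [dg' e'0 hB]]]].
    exists (I + I')%type, (fun i => match i with inl i => g i | inr i => g' i end).
    exists (Num.min e e'); split=> [[i|i]||y hy] //; first by rewrite lt_min e0.
    split; [apply: hA => i; have := hy (inl i)|apply: hB => i; have := hy (inr i)];
      by rewrite lt_min => /andP[].
  - move=> A B AB [I [g [e [dg e0 hA]]]]; exists I, g, e; split=> // y /hA.
    exact: AB.
pose Tc (f : dual X) := Topological.class (initial_topology (set_val f : X -> R^o)).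
have : F --> (x : weak_topology X).
  apply/(@cvg_sup X (dual X) Tc F x) => f.
  move=> A /=; rewrite (@nbhsE (Topological.Pack (Tc f))) => -[_ [[U oU <-] Ux] UA].
  have := oU; rewrite openE => /(_ _ Ux)/nbhs_ballP[e e0 eU].
  exists unit, (fun _ => set_val f), e; have df : dual X (set_val f) by exact: set_valP.
  split=> // y /(_ tt) hy; apply: UA; apply: eU; rewrite -ball_normE/= distrC.
  by rewrite -(linear_sub (dual_linear df)).
by move=> /(_ V); apply; apply: open_nbhs_nbhs.
Qed.

End weak_topology_theory.

(** * Convex combinations of numbers in [-1, 1] *)

Section scalar_splitting.
Context {R : realType} {n : nat} (la t : 'I_n -> R).
Hypotheses (la0 : forall i, 0 < la i) (la1 : \sum_i la i = 1).

(** Every [t i] is moved towards 1 by the same fraction [k] of its distance to 1, where [k] is fixed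
    by the required sum. *)
Lemma convex_comb_lift (s e : R) : (forall i, t i <= 1) -> s <= 1 ->
    \sum_i la i * t i <= s -> (forall i, s - \sum_i la i * t i <= e * la i) ->
  exists u, [/\ forall i, t i <= u i, forall i, u i <= 1, \sum_i la i * u i = s &
    forall i, u i - t i <= e].
Proof.
set m := \sum_i la i * t i => t1 s1 ms hs.
have [eq_ms|ne_ms] := eqVneq m s.
  exists t; split=> // i; rewrite subrr; have := hs i; rewrite eq_ms subrr.
  by rewrite pmulr_lge0.
have lt_ms : m < s by rewrite lt_def eq_sym ne_ms.
have m1 : 0 < 1 - m by rewrite subr_gt0; exact: lt_le_trans s1.
have mE : 1 - m = \sum_i la i * (1 - t i).
  under eq_bigr do rewrite mulrBr mulr1.
  by rewrite sumrB la1.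
(* This makes the move [k * (1 - t i)] at most [(s - m) / la i], hence at most [e]. *)
have part i : la i * (1 - t i) <= 1 - m.
  rewrite mE (bigD1 i)//= lerDl sumr_ge0// => j _.
  by rewrite mulr_ge0 ?(ltW (la0 _))// subr_ge0.
pose k := (s - m) / (1 - m).
have k0 : 0 <= k by rewrite divr_ge0 ?(ltW m1)// subr_ge0.
have k1 : k <= 1 by rewrite ler_pdivrMr// mul1r; lra.
have kE : k * (1 - m) = s - m by rewrite /k divfK// gt_eqF.
exists (fun i => t i + k * (1 - t i)); split=> [i|i||i].
- by rewrite lerDl mulr_ge0// subr_ge0.
- have : k * (1 - t i) <= 1 * (1 - t i) by rewrite ler_wpM2r// subr_ge0.
  by lra.
- under eq_bigr do rewrite mulrDr mulrCA.
  by rewrite big_split /= -mulr_sumr -mE kE -/m subrKC.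
- rewrite addrC addrA addNr add0r -(ler_pM2r (la0 i)).
  apply: le_trans (hs i); rewrite -kE -mulrA ler_wpM2l// mulrC.
  exact: part.
Qed.

End scalar_splitting.

(** The case where [s] is below the sum follows from the other by changing all signs. The radius [r]
    is at most every [e * la i]. *)
Lemma convex_comb_open (R : realType) n (la t : 'I_n -> R) (e : R) :
    (forall i, 0 < la i) -> \sum_i la i = 1 -> (forall i, `|t i| <= 1) -> 0 < e ->
  exists2 r, 0 < r & forall s, `|s| <= 1 -> `|s - \sum_i la i * t i| < r ->
    exists u, [/\ forall i, `|u i| <= 1, \sum_i la i * u i = s &
      forall i, `|u i - t i| <= e].
Proof.
move=> la0 la1 t1 e0.
have [r r0 hr] : exists2 r, 0 < r & forall i, r <= e * la i.
  by apply: finite_lower_bound => i; rewrite mulr_gt0.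
exists r => // s s1 hs.
have t1' i : t i <= 1 by apply: le_trans (ler_norm _) (t1 i).
have t2' i : - t i <= 1 by apply: le_trans (ler_norm _) _; rewrite normrN.
have [ms|sm] := leP (\sum_i la i * t i) s.
  have [|i|u [tu u1 us ue]] := @convex_comb_lift _ _ la t la0 la1 s e t1' _ ms.
  - by apply: le_trans (ler_norm _) s1.
  - apply: le_trans (hr i); apply: le_trans (ler_norm _) (ltW hs).
  - exists u; split=> // i; last by rewrite ger0_norm ?subr_ge0.
    rewrite ler_norml u1 andbT; apply: le_trans (tu i).
    by rewrite lerNl t2'.
have mN : \sum_i la i * - t i = - \sum_i la i * t i.
  by rewrite -sumrN; apply: eq_bigr => i _; rewrite mulrN.
have [|||u [tu u1 us ue]] := @convex_comb_lift _ _ la (fun i => - t i) la0 la1 (- s) e t2'.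
- by apply: le_trans (ler_norm _) _; rewrite normrN.
- by rewrite mN lerN2 ltW.
- move=> i; apply: le_trans (hr i); rewrite mN opprK.
  by apply: le_trans (ltW hs); rewrite distrC addrC ler_norm.
exists (fun i => - u i); split=> [i||i].
- rewrite normrN ler_norml u1 andbT; apply: le_trans (tu i).
  by rewrite lerN2.
- under eq_bigr do rewrite mulrN.
  by rewrite sumrN us opprK.
- rewrite -opprD normrN ger0_norm; have := ue i; rewrite opprK//.
  by move=> _; have := tu i; rewrite -subr_ge0 opprK.
Qed.

(** * The atomic case: convex combinations of slices *)

Section atomic_convex_combinations.
Context {R : realType} {X : normedModType R} {d : measure_display}
  {T : measurableType d} {P : set T -> (X -> R^o) -> (X -> R^o)}.
Hypothesis hP : band_projections P.
Context {n : nat} (la : 'I_n -> R) (f : 'I_n -> X -> R^o) (xs : 'I_n -> X).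
Hypotheses (la0 : forall i, 0 < la i) (la1 : \sum_i la i = 1).
Hypotheses (df : forall i, dual X (f i)) (Bxs : forall i, unit_ball X (xs i)).
Implicit Types (A : set T) (y : X).
Local Notation N := (@dual_norm R X).
Local Notation x := (\sum_i la i *: xs i).

(* [phi i] is an element of the bidual carried by the band of [A]; together
   they decompose [y] on this band the way the [xs i] decompose [x]. *)
Definition band_splitting A y (e : R) (phi : 'I_n -> (X -> R^o) -> R) :=
  [/\ forall i a g h, dual X g -> dual X h -> phi i (a *: g + h) = a * phi i g + phi i h,
      forall i g, dual X g -> phi i g <= N (P A g),
      forall g, dual X g -> \sum_i la i * phi i g = P A g y &
      forall i, P A (f i) (xs i) - e < phi i (f i)].

Definition band_splits A := forall e : R, 0 < e ->
  exists V : set (weak_topology X), [/\ open V, V x &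
    forall y, V y -> unit_ball X y -> exists phi, band_splitting A y e phi].

Lemma band_splits_null A : (forall g, dual X g -> P A g = 0) -> band_splits A.
Proof.
move=> PA0 e e0; exists setT; split=> //; first exact: openT.
move=> y _ _; exists (fun _ _ => 0); split.
- by move=> i a g h _ _; rewrite mulr0 addr0.
- by move=> i g dg; rewrite PA0// dual_norm0.
- by move=> g dg; rewrite PA0// big1// => i _; rewrite mulr0.
- by move=> i; rewrite PA0// sub0r oppr_lt0.
Qed.

(** Splittings on disjoint bands are added: the norms of the two restrictions add up, and each error
    is half of [e]. *)
Lemma band_splitsU A B : measurable A -> measurable B -> A `&` B = set0 ->
  band_splits A -> band_splits B -> band_splits (A `|` B).
Proof.
move=> mA mB AB sA sB e e0; have e2 : 0 < e / 2 by rewrite divr_gt0.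
have [V [oV Vx hV]] := sA _ e2; have [W [oW Wx hW]] := sB _ e2.
exists (V `&` W); split=> //; first exact: openI.
move=> y [Vy Wy] By.
have [phi [pl pn ps pc]] := hV y Vy By; have [psi [ql qn qs qc]] := hW y Wy By.
exists (fun i g => phi i g + psi i g); split.
- by move=> i a g h dg dh; rewrite pl// ql//; ring.
- by move=> i g dg; rewrite (band_normU hP)// lerD ?pn ?qn.
- move=> g dg; under eq_bigr do rewrite mulrDr.
  by rewrite big_split /= ps// qs// (band_setU hP).
- move=> i; rewrite (band_setU hP)//.
  change (P A (f i) (xs i) + P B (f i) (xs i) - e < phi i (f i) + psi i (f i)).
  by have := pc i; have := qc i; lra.
Qed.

(** On an atom [P A g = c g *: e] with [N e = 1], so only the numbers [e (xs i)] matter. Perturbing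
    them to [u i] with weighted sum [e y] gives [phi i g = c g * u i]. *)
Lemma band_splits_atom A : band_atom P A -> band_splits A.
Proof.
move=> [mA [e1 de1 he1]]; have [|h0] := pselect (forall g, dual X g -> P A g = 0).
  exact: band_splits_null.
have [g0 dg0 Pg0] : exists2 g, dual X g & P A g <> 0.
  apply: contrapT => h; apply: h0 => g dg; apply: contrapT => h1.
  by apply: h; exists g.
have dP0 := band_dual hP mA dg0; have N0 := band_gt0 hP mA dg0 Pg0.
pose e := (N (P A g0))^-1 *: P A g0.
have de : dual X e by exact: dualZ.
have Ne : N e = 1 by rewrite dual_normZ// gtr0_norm ?invr_gt0// mulVf ?gt_eqF.
have he g : dual X g -> exists c : R, P A g = c *: e.
  move=> dg; have [c hc] := he1 g dg; have [c0 hc0] := he1 g0 dg0.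
  have c00 : c0 != 0 by apply/eqP => c00; apply: Pg0; rewrite hc0 c00 scale0r.
  exists (c / c0 * N (P A g0)); rewrite /e scalerA -mulrA divff ?gt_eqF// mulr1.
  by rewrite {1}hc0 scalerA divfK.
(* Evaluation at a point where [e] is nonzero gives a formula for the coefficient [c g], from which
   its linearity is visible. *)
have [z ez] : exists z, e z != 0 :> R.
  apply: contrapT => h; have e0 : e = 0.
    by apply/funext => z; apply: contrapT => /eqP ez; apply: h; exists z.
  by move: Ne; rewrite e0 dual_norm0 => /eqP; rewrite eq_sym oner_eq0.
pose c g : R := P A g z / e z.
have cE g : dual X g -> P A g = c g *: e.
  move=> dg; have [c' hc'] := he g dg; rewrite /c hc'.
  by congr (_ *: _); change (c' = c' * (e z : R) / e z); rewrite mulfK.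
have cN g : dual X g -> `|c g| = N (P A g).
  by move=> dg; rewrite cE// dual_normZ// Ne mulr1.
have e_le y : unit_ball X y -> `|e y| <= 1 by move=> By; rewrite -Ne dual_norm_ubound.
move=> eta eta0.
(* An error [b] on the scalars costs at most [N (f i) * b], which stays below [eta]; the added 1
   keeps the denominator positive. *)
have [b b0 hb] : exists2 b, 0 < b & forall i, b <= eta / (1 + N (f i)).
  apply: finite_lower_bound => i; rewrite divr_gt0// ltr_pwDl//.
  exact: dual_norm_ge0.
have [r r0 hr] := @convex_comb_open R n la (fun i => e (xs i)) b la0 la1
  (fun i => e_le _ (Bxs i)) b0.
have ex : e x = \sum_i la i * e (xs i) :> R.
  rewrite (linear_bigsum (dual_linear de)); apply: eq_bigr => i _.
  exact: (linear_scale (dual_linear de)).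
exists (e @^-1` [set s : R^o | `|s - (\sum_i la i * e (xs i))| < r]); split.
- apply: weak_open_preimage => //.
  rewrite (_ : [set _ | _] = ball (\sum_i la i * e (xs i) : R^o) r).
    exact: ball_open.
  by apply/seteqP; split=> s; rewrite -ball_normE/= distrC.
- by rewrite /preimage/= ex subrr normr0.
move=> y Vy By; have [u [u1 us ue]] := hr (e y) (e_le y By) Vy.
exists (fun i g => c g * u i); split.
- move=> i a g h dg dh; rewrite /c (band_linear hP)//.
  change ((a * P A g z + P A h z) / e z * u i =
    a * (P A g z / e z * u i) + P A h z / e z * u i :> R).
  by ring.
- move=> i g dg; apply: le_trans (ler_norm _) _; rewrite normrM cN//.
  by rewrite ler_piMr// dual_norm_ge0//; exact: (band_dual hP).
- move=> g dg; under eq_bigr do rewrite mulrCA.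
  by rewrite -mulr_sumr us cE.
- move=> i; rewrite cE//.
  change (c (f i) * e (xs i) - eta < c (f i) * u i).
  rewrite ltrBlDr -ltrBlDl -mulrBr; apply: le_lt_trans (ler_norm _) _.
  rewrite normrM cN// distrC.
  have Ni := dual_norm_ge0 (df i); have N1 : 0 < 1 + N (f i) by rewrite ltr_pwDl.
  have h1 := band_contract hP mA (df i).
  apply: (@le_lt_trans _ _ (N (f i) * (eta / (1 + N (f i))))).
    apply: ler_pM => //; first by apply/dual_norm_ge0/(band_dual hP).
    exact: le_trans (ue i) (hb i).
  rewrite mulrCA -[ltRHS]mulr1 ltr_pM2l// ltr_pdivrMr// mul1r.
  by rewrite ltrDr.
Qed.

(** Exhaustion by sets all of whose measurable subsets split; this hereditary form is stable under
    unions that are not disjoint. *)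
Lemma atomic_approximation (e : R) : atomic_dual P -> 0 < e ->
  exists A, [/\ measurable A, band_splits A & forall i, N (P (~` A) (f i)) < e].
Proof.
move=> at_ e0.
pose Q := [set A | measurable A /\
  forall D, measurable D -> D `<=` A -> band_splits D].
pose nu A := \sum_i N (P A (f i)).
have wnu : finite_weight nu by apply: weight_sum => i; exact: (band_weight hP).
have Q0 : Q set0.
  split=> // D mD; rewrite subset0 => ->; apply: band_splits_null => g dg.
  exact: (band_set0 hP).
have QU A A' : Q A -> Q A' -> Q (A `|` A').
  move=> [mA QA] [mA' QA']; split=> [|D mD DAA']; first exact: measurableU.
  rewrite -(setUIDK D A); apply: band_splitsU.
  - exact: measurableI.
  - exact: measurableD.
  - by apply/seteqP; split=> // t [[_ At] [_]].
  - by apply: QA; [exact: measurableI|exact: subIsetr].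
  - apply: QA'; first exact: measurableD.
    by move=> t [/DAA'[]].
have [|A mA _ A0|A [[mA QA] _ hA]] := weight_exhaustion wnu Q0 QU _ measurableT _ e0.
- by move=> A [].
- have [i hi] : exists i, 0 < N (P A (f i)).
    apply: contrapT => h; move: A0; rewrite /nu big1 ?ltxx// => i _.
    apply/eqP; rewrite eq_le dual_norm_ge0 ?andbT; last exact: (band_dual hP).
    by rewrite leNgt; apply/negP => hi; apply: h; exists i.
  have [A' [aA' A'A hA']] := at_ _ _ (df i) mA hi.
  exists A'; split=> //.
    split=> [|D mD DA']; first by case: aA'.
    by apply: band_splits_atom; exact: (band_atom_subset hP aA').
  rewrite /nu (bigD1 i)//= ltr_pwDl// sumr_ge0// => j _.
  by apply/dual_norm_ge0/(band_dual hP) => //; case: aA'.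
- exists A; split=> // [|i]; first exact: QA.
  apply: le_lt_trans hA; rewrite /nu setTD (bigD1 i)//= lerDl sumr_ge0// => j _.
  by apply/dual_norm_ge0/(band_dual hP) => //; exact: measurableC.
Qed.

End atomic_convex_combinations.

Lemma convex_comb_slices_convex (R : realType) (X : normedModType R) (C : set X) :
  convex_comb_slices C -> convex_subset C.
Proof.
move=> [n [la [S [la0 la1 hS ->]]]] _ _ t [u Su <-] [v Sv <-] /andP[t0 t1].
exists (fun i => t *: u i + (1 - t) *: v i).
  move=> i /=; have [g [e [dg _ e0 SE]]] := hS i.
  move: (Su i) (Sv i); rewrite SE => -[Bu hu] [Bv hv]; split.
    apply: le_trans (ler_normD _ _) _; rewrite !normrZ !ger0_norm ?subr_ge0//.
    have : t * `|u i| <= t * 1 by rewrite ler_wpM2l.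
    have : (1 - t) * `|v i| <= (1 - t) * 1 by rewrite ler_wpM2l ?subr_ge0.
    by lra.
  rewrite (linear_add (dual_linear dg)) !(linear_scale (dual_linear dg)).
  set a := (X in X < _); rewrite -/a in hu hv.
  (* Strictness comes from the term in [t], so [t = 0] is treated apart. *)
  have [->|t0'] := eqVneq t 0; first by rewrite mul0r add0r subr0 mul1r.
  have tp : 0 < t by rewrite lt_def t0'.
  have : t * a < t * g (u i) by rewrite ltr_pM2l.
  have : (1 - t) * a <= (1 - t) * g (v i) by rewrite ler_wpM2l ?subr_ge0// ltW.
  by lra.
rewrite !scaler_sumr -big_split; apply: eq_bigr => i _ /=.
by rewrite scalerDr !scalerA; congr (_ *: _ + _ *: _); rewrite mulrC.
Qed.

Theorem atomic_P1bar (R : realType) (X : normedModType R) d (T : measurableType d)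
    (P : set T -> (X -> R^o) -> (X -> R^o)) :
  band_projections P -> atomic_dual P -> property_P1bar X.
Proof.
move=> hP at_ C x hC Cx; have cC := convex_comb_slices_convex hC.
have [n [la [S [la0 la1 /choice[f hf] CE]]]] := hC.
have /choice[e he] : forall i, exists e,
  [/\ dual X (f i), dual_norm (f i) <= 1, 0 < e & S i = slice (f i) e] by [].
move: Cx; rewrite {1}CE => -[xs Sxs xE].
have df i : dual X (f i) by have [] := he i.
have Bxs i : unit_ball X (xs i).
  by have := Sxs i => /=; have [_ _ _ ->] := he i; case.
have fxs i : dual_norm (f i) - e i < f i (xs i).
  by have := Sxs i => /=; have [_ _ _ ->] := he i; case.
(* A third of the slack in each slice: one share for the splitting error on [A], one each for [f i]
   at [y] and at [xs i] off [A]. *)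
have [b b0 hb] : exists2 b, 0 < b & forall i, b <= (f i (xs i) - (dual_norm (f i) - e i)) / 3.
  by apply: finite_lower_bound => i; rewrite divr_gt0// subr_gt0.
have [A [mA sA hA]] := atomic_approximation hP la0 la1 df Bxs at_ b0.
have mC := measurableC mA.
have [V [oV Vx hV]] := sA b b0.
exists (unit_ball X `&` V); split; first by exists V.
  split; last by rewrite -xE.
  rewrite -xE; apply: le_trans (ler_norm_sum _ _ _) _; rewrite -la1.
  apply: ler_sum => i _; rewrite normrZ gtr0_norm// ler_piMr ?(ltW (la0 i))//.
  exact: Bxs.
move=> y [By Vy]; have [phi [pl pn ps pc]] := hV y Vy By.
apply: contrapT => /(separate_closed_convex cC)[g [del [dg del0 hg]]].
(* The splitting is used on [A], while off [A] every [psi i] is evaluation at [y]. Each [psi i] is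
   in the bidual ball, and their weighted sum is [y] on [g]. *)
pose psi i (h : X -> R^o) : R := phi i h + P (~` A) h y.
have psiB i : bidual_ball (psi i).
  split=> [a h k dh dk|h dh].
    rewrite /psi pl// (band_linear hP)//.
    change (a * phi i h + phi i k + (a * P (~` A) h y + P (~` A) k y) =
      a * (phi i h + P (~` A) h y) + (phi i k + P (~` A) k y) :> R).
    by ring.
  rewrite /psi (band_normC hP mA dh) lerD ?pn//.
  apply: le_trans (ler_norm _) _; apply: dual_norm_ubound => //.
  exact: (band_dual hP).
have psi_sum : \sum_i la i * psi i g = g y.
  under eq_bigr do rewrite mulrDr.
  rewrite big_split /= ps// -mulr_suml la1 mul1r.
  by rewrite {3}(band_setC hP mA dg).
have psi_f i : dual_norm (f i) - e i < psi i (f i).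
  have h1 : `|P (~` A) (f i) y| <= dual_norm (P (~` A) (f i)).
    by apply: dual_norm_ubound => //; exact: (band_dual hP).
  have h2 : `|P (~` A) (f i) (xs i)| <= dual_norm (P (~` A) (f i)).
    by apply: dual_norm_ubound => //; exact: (band_dual hP).
  have h3 : f i (xs i) = P A (f i) (xs i) + P (~` A) (f i) (xs i) :> R.
    by rewrite {1}(band_setC hP mA (df i)).
  move: h1 h2; rewrite !ler_norml => /andP[h1 _] /andP[_ h2].
  by have := hb i; have := pc i; have := hA i; rewrite /psi; lra.
(* Goldstine is applied to [f i], to stay in the slice, and to [- g], to keep [g (z i)] below
   [psi i g + del / 2]; the combination of the [z i] then violates the separation. *)
have /choice[z hz] : forall i, exists z, [/\ unit_ball X z,
    dual_norm (f i) - e i < f i z & - psi i g - del / 2 < - g z].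
  move=> i.
  have [||z Bz hz] := @goldstine R X (psi i) bool
    (fun b => if b then f i else - g)
    (fun b => if b then dual_norm (f i) - e i else - psi i g - del / 2) (psiB i).
  - by case=> //; exact: dualN.
  - case=> //; have [pl' _] := psiB i.
    have -> : psi i (- g) = - psi i g.
      have p0 : psi i 0 = 0.
        by have := pl' (-1) 0 0 dual0 dual0; rewrite scaler0 addr0 mulN1r addNr.
      by have := pl' (-1) g 0 dg dual0; rewrite addr0 scaleN1r mulN1r p0 addr0.
    by rewrite gtrBl divr_gt0.
  - by exists z; split=> //; [exact: (hz true)|exact: (hz false)].
have Cz : C (\sum_i la i *: z i).
  rewrite CE; exists z => // i /=; have [_ _ _ ->] := he i.
  by have [] := hz i.
have := hg _ Cz; apply/negP; rewrite -ltNge.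
rewrite (linear_bigsum (dual_linear dg)) -psi_sum.
apply: (@le_lt_trans _ _ (\sum_i la i * (psi i g + del / 2))).
  apply: ler_sum => i _; rewrite (linear_scale (dual_linear dg)) ler_wpM2l ?(ltW (la0 i))//.
  by have [_ _] := hz i; lra.
under eq_bigr do rewrite mulrDr.
rewrite big_split /= -mulr_suml la1 mul1r ltrD2l.
by rewrite ltr_pdivrMr// ltr_pMr// ltr1n.
Qed.

(** * The diffuse case: failure of the property *)

Section diffuse_slices.
Context {R : realType} {X : normedModType R} {d : measure_display}
  {T : measurableType d} {P : set T -> (X -> R^o) -> (X -> R^o)}.
Hypothesis hP : band_projections P.
Context {F : X -> R^o} {B : set T}.
Hypothesis hFB : diffuse P F B.
Implicit Types (A D : set T) (g h : X -> R^o).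
Local Notation N := (@dual_norm R X).

Let dF : dual X F. Proof. by case: hFB. Qed.
Let mB : measurable B. Proof. by case: hFB. Qed.

(** * Balancing finitely many functionals on the diffuse set *)

Section balancing.
Context {I : finType} (g : I -> X -> R^o) (z : X).
Hypotheses (dg : forall i, dual X (g i)) (Bz : unit_ball X z).

Let m i A : R := P A (g i) z.
Let H A := N (P A F) + \sum_i N (P A (g i)).

Let wH : finite_weight H.
Proof.
have w1 := band_weight hP dF.
have w2 : finite_weight (fun A => \sum_i N (P A (g i))).
  by apply: (weight_sum) => i; exact: (band_weight hP).
split=> [A mA|A A' mA mA' AA'|G ndG mG].
- by rewrite addr_ge0 ?(weight_ge0 w1) ?(weight_ge0 w2).
- by rewrite /H (weightU w1)// (weightU w2)// addrACA.
- by apply: cvgD; [exact: (weight_cvg w1)|exact: (weight_cvg w2)].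
Qed.

Let m_le i A : measurable A -> `|m i A| <= N (P A (g i)).
Proof. by move=> mA; apply: dual_norm_ubound => //; exact: (band_dual hP). Qed.

Let mU i A A' : measurable A -> measurable A' -> A `&` A' = set0 ->
  m i (A `|` A') = m i A + m i A'.
Proof. by move=> mA mA' AA'; rewrite /m (band_setU hP). Qed.

(** From any accumulated vector [S], the values on [A'] can be added with signs (plus on [D], minus
    off it) at a cost in squared length of at most [e * H A']. Quantifying over [S] allows pieces to
    be treated one after the other. *)
Definition balanced (e : R) A := measurable A /\
  forall A', measurable A' -> A' `<=` A -> forall S : I -> R,
  exists D, [/\ measurable D, D `<=` A' &
    \sum_i (S i + (m i D - m i (A' `\` D))) ^+ 2 <= \sum_i S i ^+ 2 + e * H A'].

(** The part inside [A1] is balanced starting from [S], and the rest starting from the vector so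
    obtained. *)
Let balancedU e A1 A2 : balanced e A1 -> balanced e A2 -> balanced e (A1 `|` A2).
Proof.
move=> [mA1 h1] [mA2 h2]; split=> [|A mA A12 S]; first exact: measurableU.
have mI := measurableI _ _ mA mA1; have mD := measurableD mA mA1.
have [D1 [mD1 D1A hD1]] := h1 _ mI (@subIsetr _ _ _) S.
have [|D2 [mD2 D2A hD2]] := h2 _ mD _ (fun i => S i + (m i D1 - m i (A `&` A1 `\` D1))).
  by move=> t [/A12[]].
exists (D1 `|` D2); split.
- exact: measurableU.
- by move=> t [/D1A[]|/D2A[]].
- have -> : A `\` (D1 `|` D2) = (A `&` A1 `\` D1) `|` ((A `\` A1) `\` D2).
    apply/seteqP; split=> t /=.
      move=> [At nD]; have [A1t|A1t] := pselect (A1 t); [left|right]; split=> //.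
        by move=> ?; apply: nD; left.
      by move=> ?; apply: nD; right.
    move=> [[[At A1t] n1]|[[At A1t] n2]]; split=> // -[] //.
      by move=> /D2A[].
    by move=> /D1A[].
  have -> : H A = H (A `&` A1) + H (A `\` A1).
    rewrite -{1}(setUIDK A A1) (weightU wH)//.
    by apply/seteqP; split=> // t [[_ A1t] [_ /(_ A1t)]].
  rewrite mulrDr addrA; apply: le_trans (le_trans hD2 _); last by rewrite lerD2r.
  have mD1' := measurableD mI mD1; have mD2' := measurableD mD mD2.
  apply: ler_sum => i _; rewrite (mU i mD1 mD2); last first.
    by apply/seteqP; split=> // t [/D1A[_ A1t] /D2A[_ /(_ A1t)]].
  rewrite (mU i mD1' mD2'); last first.
    by apply/seteqP; split=> // t [[[_ A1t] _] [[_ /(_ A1t)]]].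
  by rewrite le_eqVlt; apply/orP; left; apply/eqP; congr (_ ^+ 2); ring.
Qed.

(** One sign on all of [A'] suffices: it is chosen to make the cross term nonpositive, and the
    square term is at most [H A' * H A']. *)
Let small_balanced e A : measurable A -> H A <= e -> balanced e A.
Proof.
move=> mA HA; split=> // A' mA' A'A S.
have HA' : H A' <= e by apply: le_trans (weight_le wH mA mA' A'A) HA.
have H0 : 0 <= H A' by exact: (weight_ge0 wH).
have sq : \sum_i m i A' ^+ 2 <= e * H A'.
  apply: (@le_trans _ _ (\sum_i H A' * N (P A' (g i)))).
    apply: ler_sum => i _; rewrite -[leLHS]ger0_norm ?sqr_ge0// normrX expr2.
    have mi : `|m i A'| <= N (P A' (g i)) by exact: m_le.
    apply: ler_pM => //; apply: le_trans mi _.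
    rewrite /H (bigD1 i)//= addrCA lerDl addr_ge0//.
      exact/dual_norm_ge0/(band_dual hP).
    by apply: sumr_ge0 => j _; exact/dual_norm_ge0/(band_dual hP).
  rewrite -mulr_sumr; apply: (@le_trans _ _ (H A' * H A')).
    by rewrite ler_wpM2l// /H lerDr; exact/dual_norm_ge0/(band_dual hP).
  by rewrite ler_wpM2r.
have expand (s : R) : s ^+ 2 = 1 -> \sum_i (S i + s * m i A') ^+ 2 =
    \sum_i S i ^+ 2 + (\sum_i m i A' ^+ 2 + s * (\sum_i S i * m i A' *+ 2)).
  move=> s2; rewrite mulr_sumr -!big_split; apply: eq_bigr => i _ /=.
  by rewrite sqrrD exprMn s2 mul1r; ring.
have m0 i : m i set0 = 0 by rewrite /m (band_set0 hP).
have [c0|c0] := leP (\sum_i S i * m i A' *+ 2) 0.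
  exists A'; split=> //; rewrite setDv; under eq_bigr do rewrite m0 subr0 -[m _ _]mul1r.
  by rewrite expand ?expr1n// lerD2l mul1r -[leRHS]addr0 lerD.
exists set0; split=> //; rewrite setD0.
under eq_bigr do rewrite m0 sub0r -mulN1r.
rewrite expand; last by rewrite sqrrN expr1n.
by rewrite lerD2l mulN1r -[leRHS]addr0 lerD// oppr_le0 ltW.
Qed.

(** Absence of atoms provides small sets, which are balanced; they exhaust [B] up to a remainder
    that is itself small. *)
Lemma diffuse_balanced e : 0 < e -> balanced e B.
Proof.
move=> e0; have [_ _ _ BN Bsplit] := hFB.
have Fpos A : measurable A -> A `<=` B -> 0 < H A -> 0 < N (P A F).
  move=> mA AB HA; apply: (band_gt0 hP) => // PF; move: HA.
  rewrite /H PF dual_norm0 add0r big1 ?ltxx// => i _.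
  by rewrite BN// dual_norm0.
have Hpos A : measurable A -> 0 < N (P A F) -> 0 < H A.
  move=> mA A0; rewrite ltr_pwDl// sumr_ge0// => i _.
  exact/dual_norm_ge0/(band_dual hP).
have Hsplit A : measurable A -> A `<=` B -> 0 < H A ->
    exists A', [/\ measurable A', A' `<=` A, 0 < H A' & 0 < H (A `\` A')].
  move=> mA AB /(Fpos _ mA AB)/(Bsplit _ mA AB)[A' [mA' A'A h1 h2]].
  by exists A'; split=> //; apply: Hpos => //; exact: measurableD.
have [|A [] //|A mA AB HA|G [QG GB hG]] :=
  weight_exhaustion wH (Q := balanced e) _ (@balancedU e) _ mB _ e0.
- by apply: small_balanced => //; rewrite /H (band_set0 hP)// dual_norm0 add0r big1 ?ltW// => i _;
    rewrite (band_set0 hP)// dual_norm0.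
- have [A' [mA' A'A /andP[A'0 A'e]]] := small_weight_subset wH Hsplit e0 mA AB HA.
  by exists A'; split=> //; apply: small_balanced => //; exact: ltW.
rewrite -(setDUK GB); apply: balancedU => //; apply: small_balanced; last exact: ltW.
by apply: measurableD => //; case: QG.
Qed.

Lemma exists_balanced_subset eta : 0 < eta -> exists D, [/\ measurable D, D `<=` B &
  forall i, `|P D (g i) z - P (B `\` D) (g i) z| < eta].
Proof.
move=> eta0; have H0 : 0 <= H B by exact: (weight_ge0 wH).
have H1 : 0 < 1 + H B by rewrite ltr_pwDl.
(* With the zero starting vector, this constant bounds the final sum of squares strictly below
   [eta ^+ 2]. *)
have e0 : 0 < eta ^+ 2 / (1 + H B) by rewrite divr_gt0 ?exprn_gt0.
have [_ h] := diffuse_balanced e0.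
have [D [mD DB hD]] := h B mB (fun t Bt => Bt) (fun _ => 0).
exists D; split=> // i; rewrite -(ltr_pXn2r (n := 2)) ?nnegrE ?(ltW eta0)//.
move: hD; rewrite [X in _ <= X + _]big1 ?add0r; last by move=> j _; rewrite expr0n.
move=> hD; apply: (@le_lt_trans _ _ (eta ^+ 2 / (1 + H B) * H B)); last first.
  by rewrite mulrAC ltr_pdivrMr// ltr_pM2l ?exprn_gt0// ltr_pwDl.
apply: le_trans hD; rewrite -normrX ger0_norm ?sqr_ge0// (bigD1 i)//= add0r lerDl.
by apply: sumr_ge0 => j _; exact: sqr_ge0.
Qed.

End balancing.

Let f : X -> R^o := (N (P B F))^-1 *: P B F.

Let df : dual X f. Proof. by apply: dualZ; exact: (band_dual hP). Qed.

Let Nf : N f = 1.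
Proof.
have [_ _ N0 _ _] := hFB.
by rewrite dual_normZ ?gtr0_norm ?invr_gt0 ?mulVf ?gt_eqF//; exact: (band_dual hP).
Qed.

Let PBf : P B f = f.
Proof.
by rewrite /f (bandZ hP)//; [rewrite (band_subset hP)|exact: (band_dual hP)].
Qed.

Let sgn (i : 'I_2) : R := if i == ord0 then 1 else -1.
Let C : set X := [set \sum_i (2^-1 : R) *: x i | x in
  [set x : 'I_2 -> X | forall i, slice (sgn i *: f) 4^-1 (x i)]].

Let C_slices : convex_comb_slices C.
Proof.
exists 2, (fun _ => 2^-1), (fun i => slice (sgn i *: f) 4^-1); split=> //.
- by rewrite !big_ord_recl big_ord0; lra.
- move=> i; exists (sgn i *: f), 4^-1; split=> //; first exact: dualZ.
  by rewrite dual_normZ// Nf mulr1 /sgn; case: ifP; rewrite ?normr1 ?normrN1.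
Qed.

Let sgn_norm i : N (sgn i *: f) = 1.
Proof.
by rewrite dual_normZ// Nf mulr1 /sgn; case: ifP; rewrite ?normr1 ?normrN1.
Qed.

Let C0 : C 0.
Proof.
have [z Bz hz] := dual_norm_lt df (e := 4^-1) ltac:(by rewrite invr_gt0).
exists (fun i => sgn i *: z).
  move=> i /=; split.
    rewrite /unit_ball/= normrZ; apply: le_trans Bz.
    by rewrite /sgn; case: ifP; rewrite ?normrN ?normr1 mul1r.
  change (N (sgn i *: f) - 4^-1 < sgn i * f (sgn i *: z)).
  rewrite sgn_norm (linear_scale (dual_linear df)) mulrA.
  have -> : sgn i * sgn i = 1 by rewrite /sgn; case: ifP; rewrite ?mulrNN mulr1.
  by rewrite mul1r; rewrite Nf in hz.
by rewrite !big_ord_recl big_ord0 /sgn /= scale1r scaleN1r scalerN addr0 subrr.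
Qed.

(* The two slices force their members to be close to 1 and to -1 on [B], so
   every sum is small there, whatever signs are put on [B]. *)
Let C_bound D y : measurable D -> D `<=` B -> C y ->
  (P D f - P (B `\` D) f) y <= 4^-1.
Proof.
move=> mD DB [x hx <-]; have mBD := measurableD mB mD.
have dp : dual X (P D f) by exact: (band_dual hP).
have dq : dual X (P (B `\` D) f) by exact: (band_dual hP).
have fE u : f u = P D f u + P (B `\` D) f u :> R.
  by rewrite -{1}PBf (band_setD hP mB mD DB df).
have NE : N (P D f) + N (P (B `\` D) f) = 1.
  by rewrite -(band_normD hP mB mD DB df) PBf Nf.
have [Bx0 h0] := hx ord0; have [Bx1 h1] := hx (lift ord0 ord0).
have {}h0 : 1 - 4^-1 < f (x ord0).
  by move: h0; rewrite -/(dual_norm _) sgn_norm /sgn /= scale1r.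
have {}h1 : 1 - 4^-1 < - f (x (lift ord0 ord0)).
  by move: h1; rewrite -/(dual_norm _) sgn_norm /sgn /= scaleN1r.
move: h0 h1; rewrite !fE => h0 h1.
change (P D f (\sum_i 2^-1 *: x i) - P (B `\` D) f (\sum_i 2^-1 *: x i) <= 4^-1 :> R).
rewrite !(linear_bigsum (dual_linear dp)) !(linear_bigsum (dual_linear dq)).
rewrite !big_ord_recl !big_ord0 !addr0.
rewrite !(linear_scale (dual_linear dp)) !(linear_scale (dual_linear dq)).
have := dual_norm_ubound dp Bx0; have := dual_norm_ubound dq Bx0.
have := dual_norm_ubound dp Bx1; have := dual_norm_ubound dq Bx1.
rewrite !ler_norml => /andP[a1 a2] /andP[a3 a4] /andP[a5 a6] /andP[a7 a8].
by move: h0 h1; lra.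
Qed.

Let C_bound_closure D y : measurable D -> D `<=` B -> closure C y ->
  (P D f - P (B `\` D) f) y <= 4^-1.
Proof.
move=> mD DB; set g := P D f - P (B `\` D) f => Cy.
have dg : dual X g by apply: dualB; apply: (band_dual hP) => //; exact: measurableD.
have cl : closed [set y | g y <= 4^-1].
  apply: (@closed_comp _ _ g [set s : R^o | s <= 4^-1]); last exact: closed_le.
  by move=> u _; case: dg => _; exact.
suff : closure C `<=` [set y | g y <= 4^-1] by apply.
move=> u /(closureS (B := [set y | g y <= 4^-1])) hu; rewrite ((closure_id _).1 cl); apply: hu => v; exact: C_bound.
Qed.

Theorem diffuse_not_P1bar : ~ property_P1bar X.
Proof.
move=> /(_ C 0 C_slices C0)[W [[V oV ->] [_ V0] WC]].
have [I [g [eta [dg eta0 hV]]]] := weak_open_basis oV V0.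
have [z Bz hz] := dual_norm_lt df (e := 8^-1) ltac:(by rewrite invr_gt0).
have [D [mD DB hD]] := exists_balanced_subset dg Bz eta0.
have mBD := measurableD mB mD.
(* [phi] is [z] with its sign reversed on the part of [B] outside [D], and zero off [B]. It is small
   on every [g i] but takes [rf] to [f z], which exceeds 7/8. *)
pose phi (h : X -> R^o) : R := P D h z - P (B `\` D) h z.
have phiB : bidual_ball phi.
  split=> [a h k dh dk|h dh].
    rewrite /phi !(band_linear hP)//.
    change (a * P D h z + P D k z - (a * P (B `\` D) h z + P (B `\` D) k z) =
      a * (P D h z - P (B `\` D) h z) + (P D k z - P (B `\` D) k z) :> R).
    by ring.
  apply: le_trans (band_contract hP mB dh); rewrite (band_normD hP mB mD DB dh).
  have := dual_norm_ubound (band_dual hP mD dh) Bz.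
  have := dual_norm_ubound (band_dual hP mBD dh) Bz.
  by rewrite !ler_norml /phi => /andP[? ?] /andP[? ?]; lra.
pose rf := P D f - P (B `\` D) f.
have drf : dual X rf by apply: dualB; exact: (band_dual hP).
have phi_rf : phi rf = f z.
  have dPD := band_dual hP mD df; have dPBD := band_dual hP mBD df.
  have e1 : P D rf = P D f.
    rewrite /rf (bandD hP)//; last exact: dualN.
    rewrite -scaleN1r (bandZ hP _ mD dPBD) (band_subset' hP)// (band_comp hP)//.
    by rewrite setDIK// (band_set0 hP)// scaler0 addr0.
  have e2 : P (B `\` D) rf = - P (B `\` D) f.
    rewrite /rf (bandD hP)//; last exact: dualN.
    rewrite -scaleN1r (bandZ hP _ mBD dPBD) (band_subset' hP mBD mBD)// (band_comp hP)//.
    by rewrite setIC setDIK// (band_set0 hP)// add0r scaleN1r.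
  rewrite /phi e1 e2; change (P D f z - - P (B `\` D) f z = f z :> R).
  by rewrite opprK -{3}PBf (band_setD hP mB mD DB df).
have phiN h : dual X h -> phi (- h) = - phi h.
  move=> dh; have [pl _] := phiB.
  have p0 : phi 0 = 0.
    by have := pl (-1) 0 0 dual0 dual0; rewrite scaler0 addr0 mulN1r addNr.
  by have := pl (-1) h 0 dh dual0; rewrite addr0 scaleN1r mulN1r p0 addr0.
have [||y By hy] := @goldstine R X phi (option (I + I))
  (fun o => match o with None => rf | Some (inl i) => g i | Some (inr i) => - g i end)
  (fun o => match o with None => 2^-1 | Some _ => - eta end) phiB.
- by case=> // -[] // i; exact: dualN.
- case=> [[i|i]|].
  + by have := hD i; rewrite ltr_norml => /andP[].
  + by rewrite phiN// ltrN2; have := hD i; rewrite ltr_norml => /andP[].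
  + by rewrite phi_rf; apply: lt_trans hz; rewrite Nf; lra.
have Vy : V y.
  apply: hV => i; rewrite subr0 ltr_norml (hy (Some (inl i))) /=.
  by have := hy (Some (inr i)); rewrite ltrNl opprK.
have := C_bound_closure mD DB (WC y (conj By Vy)); rewrite -/rf.
by have /= := hy None; lra.
Qed.

End diffuse_slices.

(** * The diffuse case: a copy of ell_1 *)

(** The domination by [nu] makes [m] countably additive, and [E] is the part of [A] in the positive
    set of a Hahn decomposition of [m]. *)
Lemma positive_subset (R : realType) d (T : measurableType d) (nu m : set T -> R)
    (c : R) (A : set T) : finite_weight nu ->
    (forall A B, measurable A -> measurable B -> A `&` B = set0 ->
      m (A `|` B) = m A + m B) ->
    (forall A, measurable A -> `|m A| <= c * nu A) ->
    measurable A -> 0 < m A ->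
  exists E, [/\ measurable E, E `<=` A, 0 < m E &
    forall D, measurable D -> D `<=` E -> 0 <= m D].
Proof.
move=> wnu mU mle mA mA0.
have m0 : m set0 = 0.
  by have := mU _ _ measurable0 measurable0 (set0I _); rewrite set0U; lra.
pose mu_ A := (m A)%:E.
have mu0 : mu_ set0 = 0%E by rewrite /mu_ m0.
have mufin D : measurable D -> mu_ D \is a fin_num by [].
have musig : semi_sigma_additive mu_.
  move=> G mG tG mUG.
  have c0 : 0 <= `|c| by [].
  pose U n := \big[setU/set0]_(0 <= i < n) G i.
  have mUn n : measurable (U n) by apply: bigsetU_measurable => i _.
  have sumE n : (\sum_(0 <= i < n) mu_ (G i))%E = (m (U n))%:E.
    elim: n => [|n IH]; first by rewrite /U !big_geq// m0.
    have -> : U n.+1 = U n `|` G n by rewrite /U big_nat_recr.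
    rewrite big_nat_recr//= IH /mu_ -EFinD mU//.
    apply/seteqP; split=> // t [+ Gt].
    rewrite /U big_mkord -bigcup_mkord => -[i /= ltin Git].
    have := tG i n I I (ex_intro _ t (conj Git Gt)) => eqin.
    by move: ltin; rewrite eqin ltnn.
  under eq_fun do rewrite sumE.
  apply: cvg_EFin; first by apply: nearW.
  pose V : set T := \bigcup_n G n.
  have VE : V = \bigcup_n U n.
    apply/seteqP; split=> t [n _ Gt].
      by exists n.+1 => //; rewrite /U big_mkord -bigcup_mkord; exists n => /=.
    by move: Gt; rewrite /U big_mkord -bigcup_mkord => -[i _ Gi]; exists i.
  have UV n : U n `<=` V by move=> t Ut; rewrite VE; exists n.
  have ndU : nondecreasing_seq U.
    apply/nondecreasing_seqP => n; rewrite subsetEset (_ : U n.+1 = U n `|` G n).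
      by move=> t; left.
    by rewrite /U big_nat_recr.
  have := weight_cvg wnu ndU mUn; rewrite -VE => cU.
  (* The sign of [c] is not prescribed; [1 + |c|] is a positive substitute. *)
  apply/cvgrPdist_lt => e e0; have e1 : 0 < e / (1 + `|c|) by rewrite divr_gt0// ltr_pwDl.
  move/cvgrPdist_lt : cU => /(_ _ e1); rewrite -/V; apply: filterS => n hn /=.
  have -> : m V - m (U n) = m (V `\` U n).
    rewrite -{1}(setDUK (UV n)) mU//; [by rewrite addrC addKr|exact: measurableD|exact: setDIK].
  apply: le_lt_trans (mle _ _) _; first exact: measurableD.
  have h : nu (V `\` U n) = nu V - nu (U n).
    by rewrite (weightD wnu mUG (mUn n) (UV n)) addrC addKr.
  move: hn; rewrite -h ger0_norm; last by apply: (weight_ge0 wnu); exact: measurableD.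
  rewrite ltr_pdivlMr; last by rewrite ltr_pwDl.
  apply: le_lt_trans; rewrite mulrDr mulr1 mulrC.
  have n0 : 0 <= nu (V `\` U n) by apply: (weight_ge0 wnu); exact: measurableD.
  apply: (@le_trans _ _ (nu (V `\` U n) * `|c|)); last by rewrite lerDr.
  by rewrite ler_wpM2l// ler_norm.
pose charge_m : {charge set T -> \bar R} :=
  HB.pack mu_ (isCharge.Build _ _ _ mu_ mu0 mufin musig).
have [Pos [Neg [[mPos hPos] [mNeg hNeg] PN _]]] := Hahn_decomposition charge_m.
have mI := measurableI _ _ mA mPos; have mD := measurableD mA mPos.
exists (A `&` Pos); split=> //.
  have : m A = m (A `&` Pos) + m (A `\` Pos).
    rewrite -mU// ?setUIDK//.
    by apply/seteqP; split=> // t [[_ Pt] [_ /(_ Pt)]].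
  have : m (A `\` Pos) <= 0.
    rewrite -lee_fin; apply: hNeg => // t [At nPt].
    have : (Pos `|` Neg) t by rewrite PN.
    by case.
  by lra.
by move=> D mD' DE; rewrite -lee_fin; apply: hPos => // t /DE[].
Qed.

Section diffuse_independent_sequence.
Context {R : realType} {X : normedModType R} {d : measure_display}
  {T : measurableType d} {P : set T -> (X -> R^o) -> (X -> R^o)}.
Hypothesis hP : band_projections P.
Context {F : X -> R^o} {B : set T}.
Hypothesis hFB : diffuse P F B.
Implicit Types (D : set T) (g h : X -> R^o).
Local Notation N := (@dual_norm R X).

Let dF : dual X F. Proof. by case: hFB. Qed.
Let mB : measurable B. Proof. by case: hFB. Qed.

Definition signed (b : bool) (r : R) : R := if b then r else - r.

(* [x] is at least 1/2, or at most -1/2 according to [b], on all of [A], when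
   it is seen as a density with respect to [F]. *)
Definition half_on (b : bool) (x : X) (A : set T) := forall D, measurable D ->
  D `<=` A -> 2^-1 * N (P D F) <= signed b (P D F x).

(** Each [a i] is cut in two. A point [z] almost norming [F] has its sign reversed off the first
    halves, and Goldstine replaces this bidual element by a point [x]. Inequalities on whole pieces
    become inequalities on all subsets by passing to positive sets. *)
Lemma diffuse_split_step (I : finType) (a : I -> set T) :
    (forall i, [/\ measurable (a i), a i `<=` B & 0 < N (P (a i) F)]) ->
    (forall i j, i != j -> a i `&` a j = set0) ->
  exists (x : X) (a' : I -> bool -> set T), [/\ unit_ball X x,
    forall i b, [/\ measurable (a' i b), a' i b `<=` a i & 0 < N (P (a' i b) F)],
    forall i, a' i true `&` a' i false = set0 &
    forall i b, half_on b x (a' i b)].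
Proof.
move=> ha disj.
have /choice[s hs] : forall i, exists A', [/\ measurable A', A' `<=` a i,
    0 < N (P A' F) & 0 < N (P (a i `\` A') F)].
  by move=> i; have [mi iB i0] := ha i; case: hFB => _ _ _ _; exact.
pose c i (b : bool) := if b then s i else a i `\` s i.
have mc i b : measurable (c i b).
  have [mi _ _] := ha i; have [ms _ _ _] := hs i.
  by case: b => //; exact: measurableD.
have ca i b : c i b `<=` a i.
  by have [_ sa _ _] := hs i; case: b => //; exact: subDsetl.
have c0 i b : 0 < N (P (c i b) F) by have [_ _ ? ?] := hs i; case: b.
pose D0 := \bigcup_i s i.
have mD0 : measurable D0.
  by apply: fin_bigcup_measurable => // i _; have [] := hs i.
have D0P t : D0 t <-> exists i, s i t by split=> [[i _ ?]|[i ?]]; exists i.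
have cT i : c i true `<=` D0 by move=> t st; apply/D0P; exists i.
have cF i : c i false `&` D0 = set0.
  apply/seteqP; split=> // t [[at_ ns] /D0P[j sj]].
  have [ij|/disj ij] := eqVneq i j; first by apply: ns; rewrite ij.
  have [_ sa _ _] := hs j; have : (a i `&` a j) t by split=> //; exact: sa.
  by rewrite ij.
(* If [F z] is within [e] of the norm, then on each piece [z] attains at least two thirds of the
   norm, hence more than half. *)
have [e e0 he] : exists2 e, 0 < e & forall ib : I * bool,
    e <= N (P (c ib.1 ib.2) F) / 3.
  by apply: finite_lower_bound => ib; rewrite divr_gt0.
have [z Bz hz] := dual_norm_lt dF e0.
have Pcz i b : 2^-1 * N (P (c i b) F) < P (c i b) F z.
  have mCc := measurableC (mc i b).
  have h1 := dual_norm_ubound (band_dual hP mCc dF) Bz.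
  have h2 := band_normC hP (mc i b) dF.
  have h3 : F z = P (c i b) F z + P (~` c i b) F z :> R by rewrite {1}(band_setC hP (mc i b) dF).
  have := he (i, b) => /= h4; have := c0 i b; move: h1; rewrite ler_norml => /andP[_ h1].
  by lra.
have mCD0 := measurableC mD0.
pose phi (h : X -> R^o) : R := P D0 h z - P (~` D0) h z.
have phiB : bidual_ball phi.
  split=> [r h k dh dk|h dh].
    rewrite /phi !(band_linear hP)//.
    change (r * P D0 h z + P D0 k z - (r * P (~` D0) h z + P (~` D0) k z) =
      r * (P D0 h z - P (~` D0) h z) + (P D0 k z - P (~` D0) k z) :> R).
    by ring.
  rewrite (band_normC hP mD0 dh).
  have := dual_norm_ubound (band_dual hP mD0 dh) Bz.
  have := dual_norm_ubound (band_dual hP mCD0 dh) Bz.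
  by rewrite !ler_norml /phi => /andP[? ?] /andP[? ?]; lra.
have phi_c i b : phi (P (c i b) F) = signed b (P (c i b) F z).
  case: b.
    rewrite /phi (band_subset' hP mD0 (mc i true) (cT i))// (band_comp hP mCD0 (mc i true) dF).
    have -> : ~` D0 `&` c i true = set0.
      by apply/seteqP; split=> // t [nD /cT].
    rewrite (band_set0 hP)//; change (P (c i true) F z - 0 = P (c i true) F z).
    by rewrite subr0.
  rewrite /phi (band_comp hP mD0 (mc i false) dF).
  rewrite setIC cF (band_set0 hP)// (band_subset' hP mCD0 (mc i false))//.
    by change (0 - P (c i false) F z = - P (c i false) F z); rewrite sub0r.
  move=> t ct D0t; have : (c i false `&` D0) t by [].
  by rewrite cF.
have dPc i b : dual X (P (c i b) F) by exact: (band_dual hP).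
have phiN h : dual X h -> phi (- h) = - phi h.
  move=> dh; have [pl _] := phiB.
  have p0 : phi 0 = 0.
    by have := pl (-1) 0 0 dual0 dual0; rewrite scaler0 addr0 mulN1r addNr.
  by have := pl (-1) h 0 dh dual0; rewrite addr0 scaleN1r mulN1r p0 addr0.
have [||x Bx hx] := @goldstine R X phi (I * bool)%type
  (fun ib => if ib.2 then P (c ib.1 ib.2) F else - P (c ib.1 ib.2) F)
  (fun ib => 2^-1 * N (P (c ib.1 ib.2) F)) phiB.
- by move=> [i b] /=; case: ifP => _ //; exact: dualN.
- move=> [i b]; have := Pcz i b; have := phi_c i b; case: b => e1 h1.
    by change (2^-1 * N (P (c i true) F) < phi (P (c i true) F)); rewrite e1.
  change (2^-1 * N (P (c i false) F) < phi (- P (c i false) F)).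
  by rewrite phiN// e1 opprK.
(* Nonnegativity of this charge on all measurable subsets is exactly [half_on]. *)
pose m b A : R := signed b (P A F x) - 2^-1 * N (P A F).
have mU b A A' : measurable A -> measurable A' -> A `&` A' = set0 ->
    m b (A `|` A') = m b A + m b A'.
  move=> mA mA' AA'; rewrite /m (band_setU hP)// -(band_setU hP)// (band_normU hP)//.
  rewrite (band_setU hP)//.
  have -> : (P A F + P A' F) x = P A F x + P A' F x :> R by [].
  by case: b => /=; ring.
have mle b A : measurable A -> `|m b A| <= 2 * N (P A F).
  move=> mA; have h0 := dual_norm_ge0 (band_dual hP mA dF).
  have := dual_norm_ubound (band_dual hP mA dF) Bx.
  by rewrite /m !ler_norml => /andP[? ?]; apply/andP; case: b => /=; lra.
have /choice[a' ha'] : forall ib : I * bool, exists E, [/\ measurable E,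
    E `<=` c ib.1 ib.2, 0 < m ib.2 E &
    forall D, measurable D -> D `<=` E -> 0 <= m ib.2 D].
  move=> [i b] /=; apply: (positive_subset (band_weight hP dF) (mU b) (mle b)) => //.
  by have := hx (i, b); rewrite /m subr_gt0; case: b.
exists x, (fun i b => a' (i, b)); split=> //.
- move=> i b; have [/= mE Ec E0 _] := ha' (i, b).
  split=> //; first by apply: subset_trans Ec (ca i b).
  apply: (band_gt0 hP) => // PE; move: E0; rewrite /m PE dual_norm0 mulr0 subr0.
  by case: (b); rewrite /signed/= ?oppr0 ltxx.
- move=> i; have [/= _ h1 _ _] := ha' (i, true); have [/= _ h2 _ _] := ha' (i, false).
  apply/seteqP; split=> // t [/h1 st /h2[_]]; exact.
- move=> i b D mD Da; have [/= _ _ _ h] := ha' (i, b).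
  by rewrite -subr_ge0; exact: h.
Qed.

(** The level [n] of a binary tree of disjoint sets, whose nodes are words with the most recent sign
    at the head. *)
Let good (n : nat) (a : seq bool -> set T) :=
  (forall s, size s = n -> [/\ measurable (a s), a s `<=` B & 0 < N (P (a s) F)]) /\
  (forall s t, size s = n -> size t = n -> s != t -> a s `&` a t = set0).

Let good_next n a : good n a -> exists xa : X * (seq bool -> set T),
  [/\ unit_ball X xa.1, good n.+1 xa.2,
      forall s b, size s = n -> xa.2 (b :: s) `<=` a s &
      forall s b, size s = n -> half_on b xa.1 (xa.2 (b :: s))].
Proof.
move=> [ha disj].
have [||x [a' [Bx ha' a'0 hx]]] := @diffuse_split_step (n.-tuple bool) (fun t => a t).
- by move=> t; apply: ha; exact: size_tuple.
- by move=> t u tu; apply: disj; rewrite ?size_tuple.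
(* Words are converted to tuples, which form a finite type; words of another length get the empty
   set. *)
pose a2 (s : seq bool) := if s is b :: s' then
  (if insub s' is Some t then a' (t : n.-tuple bool) b else set0) else set0.
have a2E (t : n.-tuple bool) b : a2 (b :: t) = a' t b by rewrite /a2 valK.
have tup s : size s = n -> exists t : n.-tuple bool, s = t.
  by move=> /eqP hs; exists (Tuple hs).
exists (x, a2); split=> //.
- change (good n.+1 a2); split=> [[//|b s] [/tup[t ->]]|[//|b s] [//|c u] [/tup[t ->]] [/tup[v ->]] bc].
    rewrite a2E; have [m1 s1 h1] := ha' t b; split=> //.
    by have [_ s2 _] := ha t (size_tuple t); exact: subset_trans s2.
  have [_ st _] := ha' t b; have [_ sv _] := ha' v c.
  rewrite !a2E; have [tv|tv] := eqVneq t v.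
    have {}bc : b != c by apply: contraNneq bc => ->; rewrite tv.
    by case: b c bc {st sv} => -[] // _; rewrite tv// setIC.
  have := disj t v (size_tuple t) (size_tuple v) tv.
  by move=> e; apply/seteqP; split=> // y [/st ty /sv vy]; rewrite -e.
- by move=> s b /tup[t ->]; rewrite [_.2 _]a2E; have [] := ha' t b.
- by move=> s b /tup[t ->]; rewrite [_.2 _]a2E; exact: hx.
Qed.

(** The signs of [c] select a branch of the tree. The restriction of [F] to its node at level [n]
    has, at each [x k] with [k < n], the sign of [c k] and at least half its norm; evaluating it at
    the sum gives the estimate. *)
Lemma diffuse_ell1_sequence : exists x : nat -> X, (forall n, unit_ball X (x n)) /\
  forall (c : nat -> R) n,
    2^-1 * \sum_(0 <= k < n) `|c k| <= `|\sum_(0 <= k < n) c k *: x k|.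
Proof.
have /choice[nxt hnxt] : forall na : nat * (seq bool -> set T),
    exists xa : X * (seq bool -> set T), good na.1 na.2 ->
  [/\ unit_ball X xa.1, good na.1.+1 xa.2,
      forall s b, size s = na.1 -> xa.2 (b :: s) `<=` na.2 s &
      forall s b, size s = na.1 -> half_on b xa.1 (xa.2 (b :: s))].
  move=> [n a]; have [/good_next[xa h]|h] := pselect (good n a); first by exists xa.
  by exists (0, fun _ => set0) => /h.
pose A := fix A n : seq bool -> set T :=
  if n is n'.+1 then (nxt (n', A n')).2 else fun _ => B.
pose x n := (nxt (n, A n)).1.
have gA n : good n (A n).
  elim: n => [|n IH]; last by have [] := hnxt (n, A n) IH.
  have [_ _ B0 _ _] := hFB; split=> [s _|s t]; first by split.
  by move=> /size0nil-> /size0nil->; rewrite eqxx.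
have xB n : unit_ball X (x n) by have [] := hnxt (n, A n) (gA n).
have subA n s b : size s = n -> A n.+1 (b :: s) `<=` A n s.
  by have [_ _ h _] := hnxt (n, A n) (gA n); exact: h.
have halfA n s b : size s = n -> half_on b (x n) (A n.+1 (b :: s)).
  by have [_ _ _ h] := hnxt (n, A n) (gA n); exact: h.
exists x; split=> // c n.
pose s := fix s n : seq bool := if n is n'.+1 then (0 <= c n') :: s n' else [::].
have size_s k : size (s k) = k by elim: k => //= k ->.
have nest k : (k < n)%N -> A n (s n) `<=` A k.+1 (s k.+1).
  elim: n => // n IH; rewrite ltnS leq_eqVlt => /predU1P[->//|/IH h].
  by apply: subset_trans h; exact: subA.
have [mD _ D0] := (gA n).1 (s n) (size_s n).
have dg := band_dual hP mD dF; set g := P (A n (s n)) F in D0 dg.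
rewrite -(ler_pM2l D0); apply: le_trans (dual_le_norm _ dg).
rewrite (linear_bigsum (dual_linear dg)) mulrA mulr_sumr !big_mkord.
apply: ler_sum => k _; rewrite (linear_scale (dual_linear dg)).
have := halfA k (s k) (0 <= c k) (size_s k) _ mD (nest k (ltn_ord k)).
rewrite -/g [N g * _]mulrC; case: (leP 0 (c k)) => ck /= h.
  by rewrite [leLHS]mulrC ger0_norm// ler_wpM2l.
by rewrite [leLHS]mulrC ltr0_norm// -[leRHS]mulrNN ler_wpM2l// oppr_ge0 ltW.
Qed.

End diffuse_independent_sequence.

(** Completeness makes the absolutely convergent series converge, and the inequalities for finite
    sums pass to the limit. *)
Lemma ell1_sequence_contains_ell1 (R : realType) (X : completeNormedModType R)
    (x : nat -> X) (m : R) : 0 < m -> (forall n, unit_ball X (x n)) ->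
    (forall (c : nat -> R) n,
      m * \sum_(0 <= k < n) `|c k| <= `|\sum_(0 <= k < n) c k *: x k|) ->
  contains_ell1 X.
Proof.
move=> m0 xB hx.
pose u (a : R^nat) : X^nat := fun n => a n *: x n.
have u_le a n : `|u a n| <= `|a n|.
  by rewrite /u normrZ ler_piMr//; exact: xB.
have cu a : ell1 R a -> cvgn (series (u a)).
  move=> ha; apply: normed_cvg.
  apply: (@series_le_cvg _ _ (fun n => `|a n|)) => // n; [exact: normr_ge0|exact: u_le].
exists (fun a => limn (series (u a))), m, 1; split=> //.
- move=> k a b ha hb; have -> : u (fun n => k * a n + b n) = k *: u a + u b.
    by apply/funext => n; rewrite /u scalerDl -scalerA.
  rewrite seriesD seriesZ; apply: cvg_lim; first exact: norm_hausdorff.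
  by apply: cvgD; [apply: cvgZl_tmp; exact: cu|exact: cu].
- move=> a ha; have cua := cu a ha; have cn := is_cvg_norm cua.
  have ha' : series (fun n => `|a n|) @ \oo --> ell1_norm a by exact: ha.
  have cn' : (fun n => `|series (u a) n|) @ \oo -->
      limn (fun n => `|series (u a) n|) by exact: cn.
  rewrite -lim_norm//; apply/andP; split.
    have ca : (fun n => m * series (fun n => `|a n|) n) @ \oo --> m * ell1_norm a.
      exact: cvgMl_tmp.
    by apply: (ler_cvg_to ca cn'); apply: nearW => n; exact: hx.
  rewrite mul1r; apply: (ler_cvg_to cn' ha').
  apply: nearW => n /=; apply: le_trans (ler_norm_sum _ _ _) _.
  by apply: ler_sum => k _; exact: u_le.
Qed.

(** * Sign averages of functionals over an ell_1 basis *)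

Section rademacher_average.
Context {R : realType}.
Implicit Types (h : seq bool -> R) (b : nat -> R).

Fixpoint sign_average (n : nat) h : R :=
  if n is n'.+1 then
    (sign_average n' (fun s => h (true :: s)) +
     sign_average n' (fun s => h (false :: s))) / 2
  else h [::].

Definition sign_sum (n : nat) b (s : seq bool) : R :=
  \sum_(k < n) b k * (-1) ^+ nth false s k.

Lemma sign_average_eq n h h' : (forall s, size s = n -> h s = h' s) ->
  sign_average n h = sign_average n h'.
Proof.
elim: n h h' => [|n IH] h h' hh' /=; first exact: hh'.
by congr ((_ + _) / _); apply: IH => s hs; apply: hh' => /=; rewrite hs.
Qed.

Lemma sign_average_comb n a h h' :
  sign_average n (fun s => a * h s + h' s) = a * sign_average n h + sign_average n h'.
Proof. by elim: n h h' => [|n IH] h h' //=; rewrite !IH; ring. Qed.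

Lemma sign_average_cst n (c : R) : sign_average n (fun _ => c) = c.
Proof. by elim: n => //= n ->; field. Qed.

Lemma sign_averageZ n a h : sign_average n (fun s => a * h s) = a * sign_average n h.
Proof.
have := sign_average_comb n a h (fun _ => 0).
by rewrite sign_average_cst addr0 => <-; apply: sign_average_eq => s _; rewrite addr0.
Qed.

Lemma sign_average_sum n (I : Type) (r : seq I) (h : I -> seq bool -> R) :
  sign_average n (fun s => \sum_(i <- r) h i s) = \sum_(i <- r) sign_average n (h i).
Proof.
elim: r => [|i r IH].
  rewrite big_nil -[RHS](sign_average_cst n); apply: sign_average_eq => s _.
  by rewrite big_nil.
rewrite big_cons -IH -[sign_average n (h i)]mul1r -sign_average_comb.
by apply: sign_average_eq => s _; rewrite big_cons mul1r.
Qed.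

Lemma sign_average_le n h h' : (forall s, size s = n -> h s <= h' s) ->
  sign_average n h <= sign_average n h'.
Proof.
elim: n h h' => [|n IH] h h' hh' /=; first exact: hh'.
rewrite ler_wpM2r ?invr_ge0// lerD//; apply: IH => s hs; apply: hh' => /=;
  by rewrite hs.
Qed.

Lemma sign_average_sqr_le n h :
  sign_average n h ^+ 2 <= sign_average n (fun s => h s ^+ 2).
Proof.
elim: n h => [|n IH] h //=.
apply: (@le_trans _ _ ((sign_average n (fun s => h (true :: s)) ^+ 2 +
    sign_average n (fun s => h (false :: s)) ^+ 2) / 2)).
  have := sqr_ge0 (sign_average n (fun s => h (true :: s)) -
    sign_average n (fun s => h (false :: s))); nra.
by rewrite ler_wpM2r ?invr_ge0// lerD// IH.
Qed.

(** Orthogonality of independent signs; the constant [c] absorbs the first sign in the induction. *)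
Lemma sign_average_sqr_sum n b c :
  sign_average n (fun s => (c + sign_sum n b s) ^+ 2) = c ^+ 2 + \sum_(k < n) b k ^+ 2.
Proof.
elim: n b c => [|n IH] b c /=; first by rewrite /sign_sum !big_ord0 !addr0.
have step x : sign_average n (fun s => (c + sign_sum n.+1 b (x :: s)) ^+ 2) =
    (c + b 0%N * (-1) ^+ x) ^+ 2 + \sum_(k < n) b k.+1 ^+ 2.
  rewrite -(IH (fun k => b k.+1)); apply: sign_average_eq => s _.
  by rewrite /sign_sum big_ord_recl addrA.
rewrite !step big_ord_recl /= expr1 expr0.
by field.
Qed.

End rademacher_average.

(** * Limits of bounded sequences along an ultrafilter *)

Section ultralimit.
Context {R : realType} {U : set_system nat}.
Hypotheses (UU : UltraFilter U) (Uoo : \oo `<=` U).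

(** The image of [U] is an ultrafilter containing the compact segment from [- c] to [c]. *)
Lemma bounded_ultralimit (u : nat -> R^o) (c : R) : (forall n, `|u n| <= c) ->
  u @ U --> lim (u @ U).
Proof.
move=> uc; suff : cvg (u @ U) by [].
have FU : UltraFilter (u @ U).
  split; first exact: fmap_proper_filter.
  move=> G GG UG; apply/seteqP; split=> // A GA.
  have [//|UC] := in_ultra_setVsetC (u @^-1` A) UU.
  have : G (~` A) by apply: UG.
  by move=> GC; have [x [Ax nAx]] := filter_ex (filterI GA GC); case: nAx.
have := @segment_compact R (- c) c; rewrite compact_ultra => /(_ _ FU)[].
  suff : U (u @^-1` `[- c, c]) by [].
  by apply: filterE => n; rewrite /preimage /= in_itv/= -ler_norml.
by move=> l [_ ul]; apply/cvg_ex; exists l.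
Qed.

Lemma ultralimit_le (u v : nat -> R^o) (a b : R) n0 : u @ U --> a -> v @ U --> b ->
  (forall n, (n0 <= n)%N -> u n <= v n) -> a <= b.
Proof.
move=> ua vb uv; apply: (ler_cvg_to ua vb); apply: Uoo.
by exists n0.
Qed.

End ultralimit.

(** * Functionals attached to a lower ell_1 estimate *)

Section ell1_biorthogonal.
Context {R : realType} {X : normedModType R} (e : nat -> X) (m : R).
Hypothesis m0 : 0 < m.
Hypothesis he : forall (c : nat -> R) n,
  m * \sum_(0 <= k < n) `|c k| <= `|\sum_(0 <= k < n) c k *: e k|.
Local Notation N := (@dual_norm R X).

(** Mazur-Orlicz for the cone generated by the pairs of a signed [e k] and 1; the lower ell_1
    estimate says that [m^-1] times the norm dominates this cone. *)
Lemma ell1_sign_functional n (s : seq bool) : exists phi : X -> R^o,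
  [/\ dual X phi, N phi <= m^-1 &
      forall k, (k < n)%N -> 1 <= (-1) ^+ nth false s k * phi (e k)].
Proof.
have mi : 0 <= m^-1 by rewrite invr_ge0 ltW.
pose sg k : R := (-1) ^+ nth false s k.
pose D := [set w : X * R | exists c : nat -> R, (forall k, 0 <= c k) /\
  w = (\sum_(0 <= k < n) (c k * sg k) *: e k, \sum_(0 <= k < n) c k)].
have cD : convex_cone D.
  split=> [|_ _ [c [c0 ->]] [c' [c'0 ->]]|a _ a0 [c [c0 ->]]].
  - exists (fun _ => 0); split=> //; rewrite !big1// => k _.
    by rewrite mul0r scale0r.
  - exists (fun k => c k + c' k); split=> [k|]; first exact: addr_ge0.
    congr pair; rewrite /= -big_split; apply: eq_bigr => k _ //=.
    by rewrite mulrDl scalerDl.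
  - exists (fun k => a * c k); split=> [k|]; first exact: mulr_ge0.
    congr pair; rewrite /= ?scaler_sumr ?mulr_sumr; apply: eq_bigr => k _ //.
    by rewrite scalerA mulrA.
have pD w : D w -> w.2 <= m^-1 * `|w.1|.
  move=> [c [c0 ->]] /=; rewrite ler_pdivlMl//.
  apply: le_trans (he (fun k => c k * sg k) n); rewrite ler_pM2l//.
  by apply: ler_sum => k _; rewrite normrM normr_sign mulr1 ler_norm.
have [l [ll lle lD]] := mazur_orlicz (norm_sublinear mi) cD pD.
have dl : dual X l by exact: dual_of_bound lle.
exists l; split=> // [|k kn].
  apply: dual_norm_le => // x Bx; apply: le_trans (lle x) _.
  by rewrite -[leRHS]mulr1 ler_wpM2l.
rewrite -(linear_scale ll).
have := lD (sg k *: e k, 1); apply.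
exists (fun j => (j == k)%:R); split=> [j|]; first exact: ler0n.
congr pair; rewrite big_mkord (bigD1 (Ordinal kn))//= eqxx big1 ?addr0 ?mul1r// => j jk;
  by rewrite (_ : (j == k :> nat) = false) ?mul0r ?scale0r//; apply/negbTE.
Qed.

(** Averaging over signs, [gN n k] is the mean of the sign number [k] times the sign functional. A
    combination with coefficients [b] is the mean of [sign_sum n b s] times a functional of norm at
    most [m^-1], so Cauchy-Schwarz and orthogonality of signs give the ell_2 bound. *)
Lemma ell1_biorthogonal_functionals : exists g : nat -> X -> R^o,
  [/\ forall n, dual X (g n), forall n, 1 <= g n (e n) &
    forall (b : nat -> R) n,
      N (\sum_(k < n) b k *: g k) <= m^-1 * Num.sqrt (\sum_(k < n) b k ^+ 2)].
Proof.
have mi : 0 <= m^-1 by rewrite invr_ge0 ltW.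
have /choice[phi hphi] : forall ns : nat * seq bool, exists phi : X -> R^o,
  [/\ dual X phi, N phi <= m^-1 &
    forall k, (k < ns.1)%N -> 1 <= (-1) ^+ nth false ns.2 k * phi (e k)].
  by move=> [n s]; exact: ell1_sign_functional.
have dphi n s : dual X (phi (n, s)) by have [] := hphi (n, s).
have phi_le n s x : `|phi (n, s) x| <= m^-1 * `|x|.
  have [dp pm _] := hphi (n, s); apply: le_trans (dual_normP x dp) _.
  by rewrite ler_wpM2r.
pose gN n k (x : X) : R := sign_average n (fun s => (-1) ^+ nth false s k * phi (n, s) x).
have gN_sum n (b : nat -> R) x : \sum_(k < n) b k * gN n k x =
    sign_average n (fun s => sign_sum n b s * phi (n, s) x).
  transitivity (sign_average n (fun s =>
      \sum_(k < n) b k * ((-1) ^+ nth false s k * phi (n, s) x))).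
    by rewrite sign_average_sum; apply: eq_bigr => k _; rewrite sign_averageZ.
  apply: sign_average_eq => s _; rewrite /sign_sum mulr_suml.
  by apply: eq_bigr => k _; rewrite mulrA.
have gN_sum_le n (b : nat -> R) x : \sum_(k < n) b k * gN n k x <=
    m^-1 * Num.sqrt (\sum_(k < n) b k ^+ 2) * `|x|.
  set S := \sum_(k < n) b k ^+ 2.
  have S0 : 0 <= S by apply: sumr_ge0 => k _; exact: sqr_ge0.
  have r0 : 0 <= m^-1 * Num.sqrt S * `|x| by rewrite !mulr_ge0// sqrtr_ge0.
  apply: le_trans (ler_norm _) _; rewrite -(ler_pXn2r (n := 2)) ?nnegrE//.
  rewrite real_normK ?num_real// gN_sum; apply: le_trans (sign_average_sqr_le _ _) _.
  apply: (@le_trans _ _ (sign_average n (fun s =>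
      (m^-1 * `|x|) ^+ 2 * (0 + sign_sum n b s) ^+ 2))); last first.
    rewrite sign_averageZ sign_average_sqr_sum expr0n add0r !exprMn sqr_sqrtr//.
    by rewrite le_eqVlt -/S; apply/orP; left; apply/eqP; ring.
  apply: sign_average_le => s _; rewrite add0r exprMn mulrC ler_wpM2r ?sqr_ge0//.
  rewrite -[leLHS]real_normK ?num_real// ler_pXn2r// ?nnegrE//.
  by rewrite mulr_ge0.
have gN_le n k x : `|gN n k x| <= m^-1 * `|x|.
  have sphi s : `|(-1) ^+ nth false s k * phi (n, s) x| <= m^-1 * `|x|.
    by rewrite normrM normr_sign mul1r.
  rewrite ler_norml; apply/andP; split.
    rewrite -[leLHS](sign_average_cst n); apply: sign_average_le => s _.
    by have := sphi s; rewrite ler_norml => /andP[].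
  rewrite -[leRHS](sign_average_cst n); apply: sign_average_le => s _.
  exact: le_trans (ler_norm _) (sphi s).
(* The averages at level [n] concern only indices below [n]; an ultralimit in [n] gives one sequence
   for all indices. *)
have [U [UU Uoo]] := @ultraFilterLemma _ (\oo : set_system nat) _.
pose g k (x : X) : R^o := lim ((fun n => gN n k x : R^o) @ U).
have cg k x : (fun n => gN n k x : R^o) @ U --> g k x.
  by apply: (bounded_ultralimit UU) => n; exact: gN_le.
have lg k : linear (g k).
  move=> a x y.
  have h : (fun n => gN n k (a *: x + y) : R^o) @ U --> (a * g k x + g k y : R^o).
    rewrite (_ : (fun n => _) = (fun n => a * gN n k x + gN n k y)).
      by apply: cvgD => //; apply: cvgMl_tmp; exact: cg.
    apply/funext => n; rewrite /gN -sign_average_comb; apply: sign_average_eq => s _.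
    rewrite (linear_add (dual_linear (dphi n s))) (linear_scale (dual_linear (dphi n s))).
    by ring.
  exact: (cvg_unique (@norm_hausdorff _ R^o) (cg k (a *: x + y)) h).
have dg k : dual X (g k).
  apply: (@dual_of_bound _ _ _ m^-1) => // x.
  apply: (ultralimit_le UU Uoo (n0 := 0%N) (cg k x) (cvg_cst _)) => n _.
  exact: le_trans (ler_norm _) (gN_le n k x).
exists g; split=> // [k|b n].
  apply: (ultralimit_le UU Uoo (n0 := k.+1) (cvg_cst _) (cg k (e k))) => n kn.
  rewrite -[leLHS](sign_average_cst n); apply: sign_average_le => s _.
  by have [_ _] := hphi (n, s); exact.
apply: dual_norm_le => [|x Bx].
  by apply: dual_linear; apply: dual_sum => k _; exact: dualZ.
rewrite fct_sumE.
have cs : (fun j => \sum_(k < n) b k * gN j k x : R^o) @ U -->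
    (\sum_(k < n) b k * g k x : R^o).
  elim: (index_enum _) => [|k r IH].
    by rewrite big_nil; under eq_fun do rewrite big_nil; exact: cvg_cst.
  rewrite big_cons; under eq_fun do rewrite big_cons.
  by apply: cvgD => //; apply: cvgMl_tmp; exact: cg.
apply: (ultralimit_le UU Uoo (n0 := n) cs (cvg_cst _)) => j nj.
(* The coefficients are cut at [n] so that the estimate at level [j >= n] bounds the sum of the
   first [n] terms. *)
pose b' k := if (k < n)%N then b k else 0.
have widen (h : nat -> R) : (forall k, (n <= k)%N -> h k = 0) ->
    \sum_(k < j) h k = \sum_(k < n) h k.
  move=> h0; rewrite -!(big_mkord xpredT h) (big_cat_nat (leq0n n) nj)/=.
  rewrite [X in _ + X]big_nat_cond [X in _ + X]big1 ?addr0// => k /andP[/andP[nk _] _].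
  exact: h0.
have := gN_sum_le j b' x.
rewrite (widen (fun k => b' k * gN j k x)); last first.
  by move=> k nk; rewrite /b' ltnNge nk mul0r.
rewrite (widen (fun k => b' k ^+ 2)); last first.
  by move=> k nk; rewrite /b' ltnNge nk expr0n.
have -> : \sum_(k < n) b' k * gN j k x = \sum_(k < n) b k * gN j k x.
  by apply: eq_bigr => k _; rewrite /b' ltn_ord.
have -> : \sum_(k < n) b' k ^+ 2 = \sum_(k < n) b k ^+ 2.
  by apply: eq_bigr => k _; rewrite /b' ltn_ord.
move/le_trans; apply; rewrite -[leRHS]mulr1 ler_wpM2l//.
by rewrite mulr_ge0// sqrtr_ge0.
Qed.

End ell1_biorthogonal.

(** * The atomic case: no copy of ell_1 *)

Section contains_ell1_basis.
Context {R : realType}.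
Implicit Types a c : R^nat.

Lemma big_nat_support (V : nmodType) (F : nat -> V) n n' : (n <= n')%N ->
  (forall k, (n <= k)%N -> F k = 0) ->
  \sum_(0 <= k < n') F k = \sum_(0 <= k < n) F k.
Proof.
move=> nn' F0; rewrite (big_cat_nat (leq0n n) nn') /=.
rewrite [X in _ + X]big_nat_cond [X in _ + X]big1 ?addr0// => k /andP[/andP[nk _] _].
exact: F0.
Qed.

Let trunc c n : R^nat := fun k => if (k < n)%N then c k else 0.

Let trunc_sum c n : \sum_(0 <= k < n) `|trunc c n k| = \sum_(0 <= k < n) `|c k|.
Proof. by apply: eq_big_nat => k /andP[_ kn]; rewrite /trunc kn. Qed.

Let trunc_cvg c n : series (fun k => `|trunc c n k|) @ \oo -->
  (\sum_(0 <= k < n) `|c k| : R).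
Proof.
apply: cvg_near_cst; exists n => // n' /= nn'.
rewrite -trunc_sum /series/=; apply: big_nat_support => // k nk.
by rewrite /trunc ltnNge nk normr0.
Qed.

Let ell1_trunc c n : ell1 R (trunc c n).
Proof. by apply/cvg_ex; exists (\sum_(0 <= k < n) `|c k|); exact: trunc_cvg. Qed.

Let ell1_norm_trunc c n : ell1_norm (trunc c n) = \sum_(0 <= k < n) `|c k|.
Proof. by apply: cvg_lim => //; exact: trunc_cvg. Qed.

(** The assumptions on [J] concern summable sequences only, so the computation runs over
    truncations, which are summable; [dl n] is the unit vector of index [n] written as one. *)
Lemma contains_ell1_sequence (X : normedModType R) : contains_ell1 X ->
  exists (e : nat -> X) (m M : R), [/\ 0 < m, forall n, `|e n| <= M &
    forall (c : nat -> R) n,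
      m * \sum_(0 <= k < n) `|c k| <= `|\sum_(0 <= k < n) c k *: e k|].
Proof.
move=> [J [m [M [m0 Jl Jn]]]].
pose dl n : R^nat := trunc (fun k => (k == n)%:R) n.+1.
have JE c n : J (trunc c n) = \sum_(0 <= k < n) c k *: J (dl k).
  elim: n => [|n IH].
    (* Linearity with coefficient -1 at the zero sequence gives [J] the value 0 there. *)
    have z : (fun k => -1 * trunc c 0 k + trunc c 0 k) = trunc c 0.
      by apply/funext => k; rewrite mulN1r addNr /trunc ltn0.
    have := Jl (-1) _ _ (@ell1_trunc c 0%N) (@ell1_trunc c 0%N).
    by rewrite z scaleN1r addNr big_geq.
  rewrite big_nat_recr//= -IH [RHS]addrC -Jl; [|exact: ell1_trunc|exact: ell1_trunc].
  congr (J _); apply/funext => k; rewrite /dl /trunc !ltnS leq_eqVlt.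
  have [->|kn] := eqVneq k n; first by rewrite ltnn mulr1 addr0.
  by rewrite /=; case: ifP => _; rewrite mulr0 add0r.
exists (fun n => J (dl n)), m, M; split=> // [n|c n].
  have /andP[_] := Jn _ (@ell1_trunc (fun k => (k == n)%:R) n.+1).
  rewrite ell1_norm_trunc big_nat_recr//= eqxx normr1.
  rewrite big_nat_cond big1 ?add0r ?mulr1// => k /andP[/andP[_ kn] _].
  by rewrite (ltn_eqF kn) normr0.
rewrite -JE -ell1_norm_trunc.
by have /andP[] := Jn _ (@ell1_trunc c n).
Qed.

End contains_ell1_basis.

Section atomic_no_ell1.
Context {R : realType} {X : normedModType R} {d : measure_display}
  {T : measurableType d} {P : set T -> (X -> R^o) -> (X -> R^o)}.
Hypotheses (hP : band_projections P) (at_ : atomic_dual P).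
Context (g : nat -> X -> R^o) (K c : R).
Hypotheses (dg : forall n, dual X (g n)) (c0 : 0 < c).
Local Notation N := (@dual_norm R X).
Hypothesis gc : forall n, c <= N (g n).
Hypothesis gK : forall (b : nat -> R) n,
  N (\sum_(k < n) b k *: g k) <= K * Num.sqrt (\sum_(k < n) b k ^+ 2).
Implicit Types (A : set T) (h : X -> R^o).

Definition band_vanishing A := measurable A /\ N (P A (g n)) @[n --> \oo] --> (0 : R).

(* On an atom the [g n] are multiples [a n] of one functional; testing the
   bound with the coefficients [a n] shows that [a] is square summable. *)
Lemma band_vanishing_atom A : band_atom P A -> band_vanishing A.
Proof.
move=> [mA [e de he]]; split=> //.
have /choice[a aE] : forall n, exists a : R, P A (g n) = a *: e.
  by move=> n; exact: he.
have NE n : N (P A (g n)) = `|a n| * N e by rewrite aE dual_normZ.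
have [e0|e0] := eqVneq (N e) 0.
  rewrite (_ : (fun n => _) = fun _ => 0); first exact: cvg_cst.
  by apply/funext => n; rewrite NE e0 mulr0.
have {}e0 : 0 < N e by rewrite lt_def e0 dual_norm_ge0.
pose S n := \sum_(k < n) a k ^+ 2.
have S0 n : 0 <= S n by apply: sumr_ge0 => k _; exact: sqr_ge0.
have Sle n : Num.sqrt (S n) <= `|K| / N e.
  have [s0|s0] := eqVneq (Num.sqrt (S n)) 0; first by rewrite s0 divr_ge0// ltW.
  have {}s0 : 0 < Num.sqrt (S n) by rewrite lt_def s0 sqrtr_ge0.
  have dS : dual X (\sum_(k < n) a k *: g k) by apply: dual_sum => k _; exact: dualZ.
  have := le_trans (band_contract hP mA dS) (gK a n).
  rewrite (band_sum hP)//.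
  have -> : \sum_(k < n) a k *: P A (g k) = S n *: e.
    by rewrite scaler_suml; apply: eq_bigr => k _; rewrite aE scalerA.
  rewrite dual_normZ// ger0_norm// -/(S n) -{1}(sqr_sqrtr (S0 n)) expr2 -mulrA mulrC.
  rewrite ler_pM2r// mulrC => h.
  by rewrite ler_pdivlMr// mulrC; exact: le_trans h (ler_norm K).
have cS : cvgn (series (fun k => a k ^+ 2)).
  apply: nondecreasing_is_cvgn.
    apply/nondecreasing_seqP => n; rewrite /series/= big_nat_recr//= lerDl.
    exact: sqr_ge0.
  exists ((`|K| / N e) ^+ 2) => _ [n _ <-]; rewrite /series/= big_mkord -/(S n).
  rewrite -(sqr_sqrtr (S0 n)) ler_pXn2r// ?nnegrE ?sqrtr_ge0//.
  by rewrite divr_ge0// ltW.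
have := cvg_series_cvg_0 cS => /cvgrPdist_lt a2.
apply/cvgrPdist_lt => eps eps0.
have r0 : 0 < (eps / N e) ^+ 2 by rewrite exprn_gt0// divr_gt0.
apply: filterS (a2 _ r0) => n; rewrite !sub0r !normrN normrX NE normrM normr_id.
rewrite ltr_pXn2r// ?nnegrE ?ltW ?divr_gt0// ltr_pdivlMr//.
by rewrite (ger0_norm (ltW e0)).
Qed.

Lemma band_vanishingU A A' : band_vanishing A -> band_vanishing A' ->
  band_vanishing (A `|` A').
Proof.
move=> [mA vA] [mA' vA']; split; first exact: measurableU.
have v : (fun n => N (P A (g n)) + N (P A' (g n))) @ \oo --> (0 : R).
  by rewrite -[0]addr0; apply: cvgD.
apply: (squeeze_cvgr _ (cvg_cst _) v); apply: nearW => n.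
have mU := measurableU _ _ mA mA'.
rewrite dual_norm_ge0 /=; last exact: (band_dual hP).
rewrite (band_normD hP mU mA (@subsetUl _ _ _))// lerD2l.
apply: (band_norm_le hP) => //; first exact: measurableD.
by move=> t [[]].
Qed.

(** Gliding hump: up to [eta / 4], [h] lives on a set [A] on which the [g n] tend to 0 in norm, and
    a late [g n] lives off [A] up to [eta / 4]. Each of the two errors is counted twice. *)
Lemma almost_disjoint_sum h (eta : R) n0 : dual X h -> 0 < eta ->
  exists2 n, (n0 <= n)%N & N h + N (g n) - eta <= N (h + g n).
Proof.
move=> dh eta0; have e4 : 0 < eta / 4 by rewrite divr_gt0.
have [|A [] //|A mA _ A0|A [[mA vA] _ hA]] := weight_exhaustion
  (band_weight hP dh) (Q := band_vanishing) _ band_vanishingU _ measurableT _ e4.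
- split=> //; rewrite (_ : (fun n => _) = fun _ => 0); first exact: cvg_cst.
  by apply/funext => n; rewrite (band_set0 hP)// dual_norm0.
- have [A' [aA' A'A A'0]] := at_ dh mA A0.
  by exists A'; split=> //; exact: band_vanishing_atom.
move/cvgrPdist_lt : vA => /(_ _ e4)[n1 _ hn1].
exists (maxn n0 n1); first exact: leq_maxl.
set n := maxn n0 n1.
have {hn1} := hn1 n (leq_maxr _ _); rewrite sub0r normrN => /(le_lt_trans (ler_norm _)) gn.
move: hA; rewrite setTD => hA; have mC := measurableC mA.
have dPA k : dual X k -> dual X (P A k) by exact: (band_dual hP).
have dPC k : dual X k -> dual X (P (~` A) k) by exact: (band_dual hP).
have dgn := dg n; have dhg : dual X (h + g n) by exact: dualD.
rewrite (band_normC hP mA dhg) !(bandD hP)//.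
have := dual_norm_lipschitz (dPA _ dh) (dPA _ dgn).
have := dual_norm_lipschitz (dPC _ dgn) (dPC _ dh); rewrite [P (~` A) (g n) + _]addrC.
rewrite (band_normC hP mA dh) (band_normC hP mA dgn).
by lra.
Qed.

(** Each new term adds at least [c] to the norm, up to an error [c / 2]. *)
Lemma large_sums j : exists (b : nat -> R) n, [/\ forall k, (n <= k)%N -> b k = 0,
  \sum_(0 <= k < n) b k ^+ 2 = j%:R &
  j%:R * (c / 2) <= N (\sum_(0 <= k < n) b k *: g k)].
Proof.
elim: j => [|j [b [n [b0 b2 bN]]]].
  exists (fun _ => 0), 0%N; split=> //; first by rewrite big_geq.
  by rewrite mul0r big_geq// dual_norm0.
have dh : dual X (\sum_(0 <= k < n) b k *: g k).
  by apply: dual_sum => k _; exact: dualZ.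
have c2 : 0 < c / 2 by rewrite divr_gt0.
have [n' nn' hn'] := almost_disjoint_sum n dh c2.
(* A new coefficient 1 is placed at [n']; those from [n] up to [n'] remain zero. *)
pose b' k := if k == n' then 1 else b k.
have b'E k : (0 <= k < n')%N -> b' k = b k.
  by move=> /andP[_ kn]; rewrite /b' (ltn_eqF kn).
have b'n : b' n' = 1 by rewrite /b' eqxx.
exists b', n'.+1; split=> [k n'k||].
- by rewrite /b' gtn_eqF// b0// (leq_trans nn')// ltnW.
- rewrite big_nat_recr//= b'n expr1n.
  rewrite (eq_big_nat _ _ (F2 := fun k => b k ^+ 2)); last by move=> k /b'E ->.
  rewrite (big_nat_support nn') ?b2 ?natr1// => k nk.
  by rewrite b0// expr0n.
- rewrite big_nat_recr//= b'n scale1r.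
  rewrite (eq_big_nat _ _ (F2 := fun k => b k *: g k)); last by move=> k /b'E ->.
  rewrite (big_nat_support nn'); last by move=> k nk; rewrite b0// scale0r.
  apply: le_trans hn'; have := gc n'; rewrite -natr1; lra.
Qed.

Lemma atomic_not_l2_bounded : False.
Proof.
have K1 : 0 < (2 * `|K| / c) ^+ 2 + 1 by rewrite ltr_wpDl// sqr_ge0.
(* A sum of [j] terms has norm at least [j * c / 2] and at most [K * sqrt j], so [j] cannot exceed
   the square of [2 * |K| / c]. *)
set r := (2 * `|K| / c) ^+ 2 + 1 in K1.
have [j rj] : exists j : nat, r < j%:R by exists (Num.truncn r).+1; exact: truncnS_gt.
have [b [n [_ b2 bN]]] := large_sums j.
have := le_trans bN _; rewrite big_mkord => /(_ _ (gK b n)).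
rewrite -(big_mkord xpredT (fun k => b k ^+ 2)) b2.
have j0 : 0 < j%:R :> R := lt_trans K1 rj.
have s0 : 0 < Num.sqrt (j%:R : R) by rewrite sqrtr_gt0.
rewrite -{1}(sqr_sqrtr (ltW j0)) expr2 -mulrA [leLHS]mulrC ler_pM2r// => h.
have h2 : Num.sqrt (j%:R : R) <= 2 * `|K| / c.
  by rewrite ler_pdivlMr//; have := ler_norm K; lra.
have : j%:R <= (2 * `|K| / c) ^+ 2 :> R.
  rewrite -(sqr_sqrtr (ltW j0)) ler_pXn2r// ?nnegrE ?(ltW s0)//.
  exact: le_trans (ltW s0) h2.
by move: rj; rewrite /r; lra.
Qed.

End atomic_no_ell1.

Theorem atomic_not_contains_ell1 (R : realType) (X : normedModType R) d
    (T : measurableType d) (P : set T -> (X -> R^o) -> (X -> R^o)) :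
  band_projections P -> atomic_dual P -> ~ contains_ell1 X.
Proof.
move=> hP at_ /contains_ell1_sequence[e [m [M [m0 eM he]]]].
have [g [dg ge gK]] := ell1_biorthogonal_functionals m0 he.
(* Since [g n (e n)] is at least 1 and the [e n] are bounded by [M], the norms of the [g n] are at
   least [M^-1]. *)
have gM n : 1 <= dual_norm (g n) * M.
  apply: le_trans (ge n) _; apply: le_trans (dual_le_norm _ (dg n)) _.
  by rewrite ler_wpM2l ?dual_norm_ge0.
have M0 : 0 < M.
  rewrite ltNge; apply/negP => M0; have := gM 0%N; apply/negP; rewrite -ltNge.
  by apply: le_lt_trans ltr01; rewrite mulr_ge0_le0 ?dual_norm_ge0.
apply: (@atomic_not_l2_bounded _ _ _ _ _ hP at_ g m^-1 M^-1) => // [|n].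
  by rewrite invr_gt0.
by rewrite -div1r ler_pdivrMr.
Qed.

Theorem theorem2p13 (R : realType) (X : completeNormedModType R)
  (hX : L1_predual X) :
  ~ contains_ell1 X <-> property_P1bar X.
Proof.
have [d [T [mu [J hJ]]]] := hX; have [P hP] := exists_band_projections hJ.
(* In the atomic case both sides of the equivalence hold; in the diffuse case both fail. *)
have [at_|[F [B hFB]]] := atomic_or_diffuse hP; split.
- by move=> _; exact: (atomic_P1bar hP at_).
- by move=> _; exact: (atomic_not_contains_ell1 hP at_).
- have [x [xB hx]] := diffuse_ell1_sequence hP hFB.
  have half0 : (0 < 2^-1 :> R)%R by rewrite invr_gt0.
  by case; exact: (ell1_sequence_contains_ell1 half0 xB hx).
- by move=> /(diffuse_not_P1bar hP hFB).
Qed.
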